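(* Let $\delta>0$, $\bar\rho(y)=e^{-\delta y}$, let $U^c$ be a regular internal solitary wave of speed $c$, and put $\lambda=g/c^2$. Let $\mathbb{A}(\xi;\kappa)$ be the associated spatial-dynamics operator and let $\mathfrak{B}=\{U_M^k: k\in\{1,2,3,4\},M\in\mathbb{N}\}$ be the Hilbert basis of $\mathcal{W}$, both given in the context. Then for every $N\in\mathbb{N}=\{0,1,2,\dots\}$ the equation $W'=\mathbb{A}(\xi;\kappa)W$ has, with respect to $\mathfrak{B}$, the formal finite-dimensional (Galerkin) truncation $$(E_N)\qquad \begin{pmatrix}w_0\\ \vdots\\ w_N\end{pmatrix}_\xi={}^N\!\mathcal{A}(\xi;\kappa)\begin{pmatrix}w_0\\ \vdots\\ w_N\end{pmatrix},\qquad w_M(\xi)\in\mathbb{C}^4,$$ that is, the matrix ${}^N\!\mathcal{A}(\xi;\kappa)\in\mathbb{C}^{(4N+4)\times(4N+4)}$ representing $Q_N\mathbb{A}(\xi;\kappa)Q_N$ on $\mathcal{W}_N=\operatorname{span}\{U_M^k:0\le M\le N,1\le k\le4\}$ in this basis ($Q_N$ being the orthogonal projection of $\mathcal{W}$ onto $\mathcal{W}_N$) has the $4\times4$-block form $${}^N\!\mathcal{A}(\xi;\kappa)=\begin{pmatrix}\mathcal{A}_0+\mathcal{B}_{0,0}&\mathcal{B}_{0,1}&\cdots&\mathcal{B}_{0,N}\\ \mathcal{B}_{1,0}&\mathcal{A}_1+\mathcal{B}_{1,1}&\cdots&\mathcal{B}_{1,N}\\ \vdots&\vdots&\ddots&\vdots\\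 \mathcal{B}_{N,0}&\mathcal{B}_{N,1}&\cdots&\mathcal{A}_N+\mathcal{B}_{N,N}\end{pmatrix},$$ where $$\mathcal{A}_M=\mathcal{A}_M(\kappa)=\begin{pmatrix}\frac{\kappa}{c}&0&-\frac1c&0\\0&0&1&0\\0&0&0&1\\ \delta\lambda\kappa&-\frac1c\kappa\lambda_M\delta&\delta(\lambda_M-\lambda)&\frac{\kappa}{c}\end{pmatrix}$$ and $\mathcal{B}_{ML}=\mathcal{B}_{ML}(\xi;\kappa)$ satisfies $\mathcal{B}_{ML}(\pm\infty;\kappa)=0$, i.e. $\mathcal{B}_{ML}(\xi;\kappa)\to0$ as $\xi\to\pm\infty$.
   Context: Let $g>0$, $\delta>0$ and $\bar\rho(y)=e^{-\delta y}$ on $[0,1]$. The channel is $\mathfrak{C}=\{(x,y):x\in\mathbb{R},\,0<y<1\}$. The Euler equations are $$\rho_t+u\rho_x+v\rho_y=0,\quad \rho(u_t+uu_x+vu_y)=-p_x,\quad \rho(v_t+uv_x+vv_y)=-p_y-g\rho,\quad u_x+v_y=0,$$ with boundary conditions $v(t,x,0)=v(t,x,1)=0$. The quiescent state is $\bar U(y)=(\bar\rho(y),0,0,-g\int_0^y\bar\rho(\eta)\,d\eta)^{T}$. An internal solitary wave (ISW) of speed $c>0$ is a profile $U^c(\xi,y)=(\rho^c,u^c,v^c,p^c)^{T}$ such that $U(t,x,y)=U^c(x-ct,y)$ is a classical solution of the Euler equations with these boundary conditions and $U^c(\xi,y)\to\bar U(y)$ uniformly in $y$ as $|\xi|\to\infty$.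 Its stream function $\psi^c$ is given by $\psi^c_\xi=-v^c$, $\psi^c_y=u^c$, $\psi^c(\xi,0)=\psi^c(\xi,1)=0$. The ISW is called regular if: (A1) $U^c\in C^3(\mathfrak{C})$; (A2) there are $C_1,C_2>0$ with $|\partial_\xi^\alpha\partial_y^\beta(U^c(\xi,y)-\bar U(y))|\le C_1e^{-C_2|\xi|}$ for all integers $\alpha,\beta\ge0$ with $\alpha+\beta\le3$; (A3) each level set $\{\rho^c=\varrho\}$, $\varrho\in\operatorname{range}\bar\rho$, is the graph $y=Y^\varrho(\xi)$ of a differentiable $Y^\varrho:\mathbb{R}\to[0,1]$. For a regular ISW, $\rho^c>0$ and $\psi^c_y-c\ne0$ on $\mathbb{R}\times[0,1]$. Space and basis. $\mathcal{W}=(L^2(0,1))^4$ with $\langle U,V\rangle=\int_0^1(-\bar\rho')\big(\tfrac{U_1V_1}{(\bar\rho')^2}+U_2V_2+U_3V_3+U_4V_4\big)dy$. Let $0<\lambda_0<\lambda_1<\cdots\to\infty$ and (real) $\varphi_0,\varphi_1,\dots$ be the eigenvalues and eigenfunctions of $(\bar\rho\varphi')'=\lambda\bar\rho'\varphi$, $\varphi(0)=\varphi(1)=0$, normalized by $\int_0^1(-\bar\rho')\varphi_n\varphi_m\,dy=\delta_{nm}$. Set $U_M^1=(\bar\rho'\varphi_M,0,0,0)^{T}$, $U_M^2=(0,\varphi_M,0,0)^{T}$, $U_M^3=(0,0,\varphi_M,0)^{T}$, $U_M^4=(0,0,0,\varphi_M)^{T}$; these form a Hilbert basis of $\mathcal{W}$.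 Operator. For $\kappa\in\mathbb{C}$, $$\mathbb{A}(\xi;\kappa)=\begin{pmatrix}R_1&R_2&R_3&0\\0&0&1&0\\0&0&0&1\\S_1&S_2&S_3&S_4\end{pmatrix},\qquad R_j=\frac{\tilde R_j}{\psi^c_y-c},\quad S_k=\frac{\tilde S_k}{(\psi^c_y-c)\rho^c},$$ $$\begin{aligned} \tilde R_1&=-\kappa+\psi^c_\xi\partial_y,\qquad \tilde R_2=-\rho^c_\xi\partial_y,\qquad \tilde R_3=\rho^c_y,\\ \tilde S_1&=\big[-(\psi^c_y-c)(\psi^c_{\xi yy}+\psi^c_{\xi\xi\xi})+\psi^c_\xi(\psi^c_{yyy}+\psi^c_{\xi\xi y})-(\psi^c_y-c)^{-1}(g\kappa+\kappa\psi^c_\xi\psi^c_{\xi y})+\kappa\psi^c_{\xi\xi}\big]\\ &\quad+\big[-(\psi^c_y-c)\psi^c_{\xi y}+\psi^c_\xi\psi^c_{yy}-\psi^c_\xi\psi^c_{\xi\xi}+(\psi^c_y-c)^{-1}(g\psi^c_\xi+(\psi^c_\xi)^2\psi^c_{\xi y})\big]\partial_y,\\ \tilde S_2&=\big[-\rho^c_y\psi^c_{\xi y}-\rho^c\psi^c_{\xi yy}-\rho^c\psi^c_{\xi\xi\xi}-(\psi^c_y-c)^{-1}(g\rho^c_\xi+\rho^c_\xi\psi^c_\xi\psi^c_{\xi y})-\kappa\rho^c_y\big]\partial_y\\ &\quad+\big[\rho^c_y\psi^c_\xi-\kappa\rho^c\big]\partial_{yy}+\big[\rho^c\psi^c_\xi\big]\partial_{yyy},\\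 \tilde S_3&=\big[\rho^c_y\psi^c_{yy}+\rho^c_\xi\psi^c_{\xi y}+\rho^c\psi^c_{yyy}+\rho^c\psi^c_{\xi\xi y}-\rho^c_y\psi^c_{\xi\xi}+(\psi^c_y-c)^{-1}(g\rho^c_y+\rho^c_y\psi^c_\xi\psi^c_{\xi y})-\kappa\rho^c_\xi\big]\\ &\quad+\big[-\rho^c_y(\psi^c_y-c)+\rho^c_\xi\psi^c_\xi\big]\partial_y+\big[-\rho^c(\psi^c_y-c)\big]\partial_{yy},\\ \tilde S_4&=\big[-\rho^c_\xi(\psi^c_y-c)-\kappa\rho^c\big]+\big[\rho^c\psi^c_\xi\big]\partial_y. \end{aligned}$$ The entries of the matrix of $Q_N\mathbb{A}Q_N$ are $\langle\mathbb{A}(\xi;\kappa)U_L^k,U_M^l\rangle$ (row index $(M,l)$, column index $(L,k)$). *)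

(* Defs.v *)
(* Stdlib reals with Coquelicot. *)
From Stdlib Require Import Reals Arith.
From Coquelicot Require Import Coquelicot.
Open Scope R_scope.

(* Functions on the channel R x (0,1), or on its closure, are total functions
   R -> R -> R of (xi, y).  Derivatives are only ever constrained, and only
   matter, at interior points 0 < y < 1, where they do not depend on the values
   outside the channel. *)

Definition rhobar (delta y : R) : R := exp (- delta * y).

Record profile : Type := Profile {
  rho : R -> R -> R;
  vel_u : R -> R -> R;
  vel_v : R -> R -> R;
  pres : R -> R -> R
}.

Definition quiescent (g delta : R) : profile := {|
  rho := fun _ y => rhobar delta y;
  vel_u := fun _ _ => 0;
  vel_v := fun _ _ => 0;
  pres := fun _ y => - g * RInt (rhobar delta) 0 y
|}.

Definition componentwise (P : (R -> R -> R) -> (R -> R -> R) -> Prop)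
    (U V : profile) : Prop :=
  P (rho U) (rho V) /\ P (vel_u U) (vel_u V) /\
  P (vel_v U) (vel_v V) /\ P (pres U) (pres V).

Definition d_t (f : R -> R -> R -> R) (t x y : R) : R :=
  Derive (fun s => f s x y) t.
Definition d_x (f : R -> R -> R -> R) (t x y : R) : R :=
  Derive (fun s => f t s y) x.
Definition d_y (f : R -> R -> R -> R) (t x y : R) : R :=
  Derive (fun s => f t x s) y.

(* Continuous on the closed channel for all times, C^1 on the open channel. *)
Definition classical (f : R -> R -> R -> R) : Prop :=
  let uncurried (h : R -> R -> R -> R) (z : R * R * R) : R :=
    h (fst (fst z)) (snd (fst z)) (snd z) in
  continuous_on (fun z : R * R * R => 0 <= snd z <= 1) (uncurried f) /\
  forall t x y, 0 < y < 1 ->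
    ex_derive (fun s => f s x y) t /\
    ex_derive (fun s => f t s y) x /\
    ex_derive (fun s => f t x s) y /\
    continuous (uncurried (d_t f)) (t, x, y) /\
    continuous (uncurried (d_x f)) (t, x, y) /\
    continuous (uncurried (d_y f)) (t, x, y).

Definition euler_solution (g : R) (r u v p : R -> R -> R -> R) : Prop :=
  classical r /\ classical u /\ classical v /\ classical p /\
  (forall t x y, 0 < y < 1 ->
     d_t r t x y + u t x y * d_x r t x y + v t x y * d_y r t x y = 0 /\
     r t x y * (d_t u t x y + u t x y * d_x u t x y + v t x y * d_y u t x y)
       = - d_x p t x y /\
     r t x y * (d_t v t x y + u t x y * d_x v t x y + v t x y * d_y v t x y)
       = - d_y p t x y - g * r t x y /\
     d_x u t x y + d_y v t x y = 0) /\
  (forall t x, v t x 0 = 0 /\ v t x 1 = 0).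

Definition travelling (c : R) (f : R -> R -> R) (t x y : R) : R :=
  f (x - c * t) y.

Definition internal_solitary_wave (g delta c : R) (U : profile) : Prop :=
  0 < c /\
  euler_solution g (travelling c (rho U)) (travelling c (vel_u U))
                   (travelling c (vel_v U)) (travelling c (pres U)) /\
  componentwise
    (fun f fbar => forall eps, 0 < eps -> exists X, forall xi y,
       X < Rabs xi -> 0 <= y <= 1 -> Rabs (f xi y - fbar xi y) < eps)
    U (quiescent g delta).

Definition regular_isw (g delta c : R) (U : profile) : Prop :=
  internal_solitary_wave g delta c U /\
  (forall xi y, 0 < y < 1 ->
     ex_diff_n (rho U) 3 xi y /\ ex_diff_n (vel_u U) 3 xi y /\
     ex_diff_n (vel_v U) 3 xi y /\ ex_diff_n (pres U) 3 xi y) /\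
  (exists C1 C2, 0 < C1 /\ 0 < C2 /\
     componentwise
       (fun f fbar => forall (a b : nat) xi y, (a + b <= 3)%nat -> 0 < y < 1 ->
          Rabs (partial_derive a b (fun s z => f s z - fbar s z) xi y)
            <= C1 * exp (- C2 * Rabs xi))
       U (quiescent g delta)) /\
  (forall r, (exists y, 0 <= y <= 1 /\ r = rhobar delta y) ->
     exists Y : R -> R,
       (forall xi, ex_derive Y xi) /\
       (forall xi, 0 <= Y xi <= 1) /\
       (forall xi y, 0 <= y <= 1 -> (rho U xi y = r <-> y = Y xi))).

Definition stream_function (U : profile) (psi : R -> R -> R) : Prop :=
  continuous_on (fun z : R * R => 0 <= snd z <= 1)
                (fun z => psi (fst z) (snd z)) /\
  (forall xi y, 0 < y < 1 ->
     is_derive (fun s => psi s y) xi (- vel_v U xi y) /\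
     is_derive (fun z => psi xi z) y (vel_u U xi y)) /\
  (forall xi, psi xi 0 = 0 /\ psi xi 1 = 0).

Definition eigenfunction (delta mu : R) (chi : R -> R) : Prop :=
  continuous_on (fun y => 0 <= y <= 1) chi /\
  (exists y, 0 <= y <= 1 /\ chi y <> 0) /\
  chi 0 = 0 /\ chi 1 = 0 /\
  (forall y, 0 < y < 1 ->
     ex_derive chi y /\
     is_derive (fun z => rhobar delta z * Derive chi z) y
               (mu * Derive (rhobar delta) y * chi y)).

Definition eigensystem (delta : R) (lam : nat -> R) (phi : nat -> R -> R)
    : Prop :=
  0 < lam 0%nat /\
  (forall n, lam n < lam (S n)) /\
  is_lim_seq lam p_infty /\
  (forall n, eigenfunction delta (lam n) (phi n)) /\
  (forall mu chi, eigenfunction delta mu chi -> exists n, mu = lam n) /\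
  (forall n m,
     RInt (fun y => - Derive (rhobar delta) y * phi n y * phi m y) 0 1
       = if Nat.eqb n m then 1 else 0).

(* An element of L^2(0,1)^4 is given by its components, numbered 0, 1, 2, 3
   (all indices in {1,2,3,4} are shifted down by one); components of index
   4 and above carry no information. *)
Definition state : Type := nat -> R -> C.

(* No conjugation: the second argument is only ever a (real) basis element.
   The values of the integrand at 0 and 1, where the derivatives in the operator
   have no meaning, do not affect the Riemann integral. *)
Definition inner (delta : R) (U V : state) : C :=
  RInt (V := C_R_CompleteNormedModule)
    (fun y =>
       (RtoC (- Derive (rhobar delta) y) *
        (U 0%nat y * V 0%nat y / (RtoC (Derive (rhobar delta) y)) ^ 2
         + U 1%nat y * V 1%nat y + U 2%nat y * V 2%nat y
         + U 3%nat y * V 3%nat y))%C) 0 1.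

(* basis delta phi M k is U_M^{k+1}. *)
Definition basis (delta : R) (phi : nat -> R -> R) (M k : nat) : state :=
  fun j y =>
    if Nat.eqb j k then
      match k with
      | O => RtoC (Derive (rhobar delta) y * phi M y)
      | _ => RtoC (phi M y)
      end
    else RtoC 0.

(* The basis of W_N, enumerated as U_0^1, ..., U_0^4, U_1^1, ..., U_N^4. *)
Definition basis_seq (delta : R) (phi : nat -> R -> R) (i : nat) : state :=
  basis delta phi (i / 4) (i mod 4).

Definition lincomb (delta : R) (phi : nat -> R -> R) (N : nat) (w : nat -> C)
    : state :=
  fun j y =>
    sum_n (fun i => (w i * basis_seq delta phi i j y)%C) (4 * N + 3).

(* Q_N; the basis is orthonormal. *)
Definition proj (delta : R) (phi : nat -> R -> R) (N : nat) (W : state)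
    : state :=
  lincomb delta phi N (fun i => inner delta W (basis_seq delta phi i)).

Definition dy (n : nat) (f : R -> C) (y : R) : C :=
  (Derive_n (fun z => fst (f z)) n y, Derive_n (fun z => snd (f z)) n y).

Definition pd (a b : nat) (f : R -> R -> R) (xi y : R) : C :=
  RtoC (partial_derive a b f xi y).

Section Operator.
Local Open Scope C_scope.

(* In what follows q is psi_y - c. *)

Definition opR1 (c : R) (psi : R -> R -> R) (kappa : C) (xi : R) (f : R -> C)
    (y : R) : C :=
  let q := pd 0 1 psi xi y - RtoC c in
  (- kappa * f y + pd 1 0 psi xi y * dy 1 f y) / q.

Definition opR2 (c : R) (r psi : R -> R -> R) (xi : R) (f : R -> C)
    (y : R) : C :=
  let q := pd 0 1 psi xi y - RtoC c in
  (- pd 1 0 r xi y * dy 1 f y) / q.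

Definition opR3 (c : R) (r psi : R -> R -> R) (xi : R) (f : R -> C)
    (y : R) : C :=
  let q := pd 0 1 psi xi y - RtoC c in
  (pd 0 1 r xi y * f y) / q.

Definition opS1 (g c : R) (r psi : R -> R -> R) (kappa : C) (xi : R)
    (f : R -> C) (y : R) : C :=
  let p a b := pd a b psi xi y in
  let q := p 0%nat 1%nat - RtoC c in
  ((- q * (p 1%nat 2%nat + p 3%nat 0%nat)
    + p 1%nat 0%nat * (p 0%nat 3%nat + p 2%nat 1%nat)
    - / q * (RtoC g * kappa + kappa * p 1%nat 0%nat * p 1%nat 1%nat)
    + kappa * p 2%nat 0%nat) * f y
   + (- q * p 1%nat 1%nat + p 1%nat 0%nat * p 0%nat 2%nat
      - p 1%nat 0%nat * p 2%nat 0%nat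
      + / q * (RtoC g * p 1%nat 0%nat + (p 1%nat 0%nat) ^ 2 * p 1%nat 1%nat))
     * dy 1 f y)
  / (q * RtoC (r xi y)).

Definition opS2 (g c : R) (r psi : R -> R -> R) (kappa : C) (xi : R)
    (f : R -> C) (y : R) : C :=
  let p a b := pd a b psi xi y in
  let q := p 0%nat 1%nat - RtoC c in
  let r0 := RtoC (r xi y) in
  let rx := pd 1 0 r xi y in
  let ry := pd 0 1 r xi y in
  ((- ry * p 1%nat 1%nat - r0 * p 1%nat 2%nat - r0 * p 3%nat 0%nat
    - / q * (RtoC g * rx + rx * p 1%nat 0%nat * p 1%nat 1%nat)
    - kappa * ry) * dy 1 f y
   + (ry * p 1%nat 0%nat - kappa * r0) * dy 2 f y
   + (r0 * p 1%nat 0%nat) * dy 3 f y)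
  / (q * r0).

Definition opS3 (g c : R) (r psi : R -> R -> R) (kappa : C) (xi : R)
    (f : R -> C) (y : R) : C :=
  let p a b := pd a b psi xi y in
  let q := p 0%nat 1%nat - RtoC c in
  let r0 := RtoC (r xi y) in
  let rx := pd 1 0 r xi y in
  let ry := pd 0 1 r xi y in
  ((ry * p 0%nat 2%nat + rx * p 1%nat 1%nat + r0 * p 0%nat 3%nat
    + r0 * p 2%nat 1%nat - ry * p 2%nat 0%nat
    + / q * (RtoC g * ry + ry * p 1%nat 0%nat * p 1%nat 1%nat)
    - kappa * rx) * f y
   + (- ry * q + rx * p 1%nat 0%nat) * dy 1 f y
   + (- r0 * q) * dy 2 f y)
  / (q * r0).

Definition opS4 (c : R) (r psi : R -> R -> R) (kappa : C) (xi : R)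
    (f : R -> C) (y : R) : C :=
  let q := pd 0 1 psi xi y - RtoC c in
  let r0 := RtoC (r xi y) in
  ((- pd 1 0 r xi y * q - kappa * r0) * f y
   + (r0 * pd 1 0 psi xi y) * dy 1 f y)
  / (q * r0).

Definition opA (g c : R) (r psi : R -> R -> R) (xi : R) (kappa : C)
    (W : state) : state :=
  fun j y =>
    match j with
    | 0%nat => opR1 c psi kappa xi (W 0%nat) y + opR2 c r psi xi (W 1%nat) y
               + opR3 c r psi xi (W 2%nat) y
    | 1%nat => W 2%nat y
    | 2%nat => W 3%nat y
    | 3%nat => opS1 g c r psi kappa xi (W 0%nat) y
               + opS2 g c r psi kappa xi (W 1%nat) y
               + opS3 g c r psi kappa xi (W 2%nat) y
               + opS4 c r psi kappa xi (W 3%nat) y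
    | _ => 0
    end.

(* A_M(kappa), with lambda = g / c^2 and lamM = lambda_M. *)
Definition calA (g delta c lamM : R) (kappa : C) : @matrix C 4 4 :=
  let lambda : R := (g / c ^ 2)%R in
  mk_matrix 4 4 (fun i j =>
    match i, j with
    | 0%nat, 0%nat => kappa / RtoC c
    | 0%nat, 2%nat => - (1 / RtoC c)
    | 1%nat, 2%nat => 1
    | 2%nat, 3%nat => 1
    | 3%nat, 0%nat => RtoC delta * RtoC lambda * kappa
    | 3%nat, 1%nat => - (1 / RtoC c) * kappa * RtoC lamM * RtoC delta
    | 3%nat, 2%nat => RtoC delta * (RtoC lamM - RtoC lambda)
    | 3%nat, 3%nat => kappa / RtoC c
    | _, _ => 0
    end).

End Operator.

Definition block_matrix (N : nat) (F : nat -> nat -> @matrix C 4 4)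
    : @matrix C (4 * N + 4) (4 * N + 4) :=
  mk_matrix (4 * N + 4) (4 * N + 4) (fun i j =>
    coeff_mat (RtoC 0) (F (i / 4) (j / 4))%nat (i mod 4) (j mod 4)).

Definition galerkin_matrix (delta : R) (phi : nat -> R -> R) (N : nat)
    (T : state -> state) : @matrix C (4 * N + 4) (4 * N + 4) :=
  mk_matrix (4 * N + 4) (4 * N + 4) (fun i j =>
    inner delta (T (basis_seq delta phi j)) (basis_seq delta phi i)).

(* G is the matrix of T on W_N: its columns hold the coordinates of the images
   of the basis vectors. *)
Definition represents (delta : R) (phi : nat -> R -> R) (N : nat)
    (T : state -> state) (G : @matrix C (4 * N + 4) (4 * N + 4)) : Prop :=
  forall i : nat, (i < 4 * N + 4)%nat ->
  forall (j : nat) (y : R), (j < 4)%nat -> 0 <= y <= 1 ->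
    T (basis_seq delta phi i) j y
      = lincomb delta phi N (fun k => coeff_mat (RtoC 0) G k i) j y.

(* Main.v *)
Require Import Defs.
From Stdlib Require Import Reals Arith Lra Lia FunctionalExtensionality.
From Coquelicot Require Import Coquelicot.
Open Scope R_scope.

(* The blocks B_ML are the Galerkin matrix entries minus those of A_M, so only
   their decay is at stake.  By (A2), as |xi| -> oo the coefficients of the
   operator converge uniformly on 0 < y < 1 to those of the operator of the
   quiescent state (all derivatives of psi and rho_xi vanish, rho -> rhobar,
   rho_y -> rhobar'), and the eigenvalue equation in the form
   phi'' = delta (phi' - lambda phi) shows that the limit operator maps each
   basis element of index L into the span of those of index L, acting there as
   A_L.  The denominators psi_y - c and rho are bounded away from 0 for large
   |xi|, which is all that the limit needs.  Third derivatives are only known to be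
   bounded and continuous on the open interval, so the integrals require that such
   functions are Riemann integrable. *)

(** * Riemann integrability *)

Lemma continuous_clamp (lo hi x : R) :
  continuous (fun x => Rmax lo (Rmin hi x)) x.
Proof.
apply continuity_pt_filterlim.
(* Once max and min are written through absolute values, [reg] can prove the continuity. *)
apply (continuity_pt_ext
  (fun x => (lo + ((hi + x - Rabs (hi - x)) / 2)
    + Rabs (lo - ((hi + x - Rabs (hi - x)) / 2))) / 2)).
{ intros t; unfold Rmax, Rmin; repeat destruct Rle_dec;
    repeat match goal with
      |- context [Rabs ?u] => destruct (Rcase_abs u);
        [rewrite (Rabs_left u) by lra | rewrite (Rabs_right u) by lra]
    end; lra. }
reg.
Qed.

(** Away from the two ends, [f] agrees with its composition with a clamp into a compact subinterval,
    which is continuous on the whole line. Near the ends the two differ by at most [2 * K] on a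
    total length of [2 * eta], at a cost of [4 * K * eta]. *)
Lemma Riemann_integrable_bounded_continuous (f : R -> R) (a b K : R) :
  a < b ->
  (forall x, a < x < b -> continuous f x) ->
  (forall x, a <= x <= b -> Rabs (f x) <= K) ->
  Riemann_integrable f a b.
Proof.
intros hab hcont hK eps.
assert (hK0 : 0 <= K).
{ apply Rle_trans with (2 := hK a ltac:(lra)); apply Rabs_pos. }
assert (heps := cond_pos eps).
(* The first bound keeps [a + eta] below [b - eta], the second makes [4 * K * eta] less than [eps];
   the 1 added to [K] avoids a division by zero. *)
set (eta := Rmin ((b - a) / 4) (eps / (8 * (K + 1)))).
assert (heta : 0 < eta).
{ apply Rmin_pos; [lra | apply Rdiv_lt_0_compat; lra]. }
assert (heta1 : eta <= (b - a) / 4) by apply Rmin_l.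
assert (heta2 : 4 * K * eta < eps).
{ apply Rle_lt_trans with (4 * K * (eps / (8 * (K + 1)))).
  - apply Rmult_le_compat_l; [lra | apply Rmin_r].
  - replace (4 * K * (eps / (8 * (K + 1)))) with (eps / 2 * (K / (K + 1)))
      by (field; lra).
    assert (K / (K + 1) <= 1) by (apply Rle_div_l; lra).
    assert (0 <= K / (K + 1)) by (apply Rdiv_le_0_compat; lra).
    nra. }
set (clamp := fun x => Rmax (a + eta) (Rmin (b - eta) x)).
assert (hclamp : forall x, a < clamp x < b).
{ intros x; unfold clamp, Rmax, Rmin; repeat destruct Rle_dec; lra. }
assert (hint : Riemann_integrable (fun x => f (clamp x)) a b).
{ apply ex_RInt_Reals_0, (ex_RInt_continuous (V := R_CompleteNormedModule)); intros x _.
  apply (continuous_comp clamp f); [ | now apply hcont].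
  unfold clamp.
  apply continuous_clamp. }
(* The approximation of the clamped function gets half of the tolerance that the two ends leave
   over. *)
destruct (hint (mkposreal _ (is_pos_div_2 (mkposreal _ (proj2 (Rlt_0_minus _ _) heta2)))))
  as [phi [psi [hphi hpsi]]].
(* This step function dominates the error made by clamping; added to [psi], it bounds the distance
   from [f] to [phi]. *)
set (h := fun x => if Rlt_dec (a + eta) x
                   then if Rlt_dec x (b - eta) then 0 else 2 * K else 2 * K).
assert (hh : adapted_couple h a b (a :: a + eta :: b - eta :: b :: nil)
                                  (2 * K :: 0 :: 2 * K :: nil)).
{ repeat split.
  - intros [ | [ | [ | i]]]; simpl; intros; lra || lia.
  - simpl; rewrite Rmin_left; lra.
  - simpl; rewrite Rmax_right; lra.
  - intros [ | [ | [ | i]]]; simpl; intros hi x hx; try lia;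
      destruct hx as [hx1 hx2]; unfold h;
      repeat destruct Rlt_dec; lra. }
set (hs := mkStepFun (existT _ _ (existT _ _ hh) : IsStepFun h a b)).
exists phi, (mkStepFun (StepFun_P28 1 hs psi)); split.
- intros x hx; simpl.
  assert (hx' := hphi x hx); rewrite Rmin_left, Rmax_right in hx by lra.
  apply Rle_trans with (Rabs (f x - f (clamp x)) + Rabs (f (clamp x) - phi x)).
  { replace (f x - phi x) with ((f x - f (clamp x)) + (f (clamp x) - phi x))
      by ring; apply Rabs_triang. }
  enough (Rabs (f x - f (clamp x)) <= h x) by (simpl in hx'; lra).
  assert (hbig : Rabs (f x - f (clamp x)) <= 2 * K).
  { apply Rle_trans with (1 := Rabs_triang _ _); rewrite Rabs_Ropp.
    assert (h1 := hK x hx); assert (h2 := hclamp x).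
    assert (h3 := hK (clamp x) ltac:(lra)); lra. }
  unfold h; destruct Rlt_dec; [destruct Rlt_dec | ]; try assumption.
  unfold clamp; rewrite (Rmin_right (b - eta)), Rmax_right by lra.
  rewrite Rminus_diag, Rabs_R0; lra.
- rewrite StepFun_P30.
  assert (hhs : RiemannInt_SF hs = 4 * K * eta).
  { unfold RiemannInt_SF; destruct Rle_dec; [simpl; ring | lra]. }
  rewrite hhs; simpl in hpsi.
  apply Rle_lt_trans with (1 := Rabs_triang _ _).
  rewrite Rabs_pos_eq by nra.
  rewrite Rmult_1_l; lra.
Qed.

Lemma ex_RInt_bounded_continuous (f : R -> R) (a b K : R) :
  a < b ->
  (forall x, a < x < b -> continuous f x) ->
  (forall x, a < x < b -> Rabs (f x) <= K) ->
  ex_RInt f a b.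
Proof.
intros hab hcont hK.
assert (hK0 : 0 <= K).
{ apply Rle_trans with (2 := hK ((a + b) / 2) ltac:(lra)); apply Rabs_pos. }
(* The values of [f] at the ends are arbitrary; replacing them by 0 extends the bound to the closed
   interval and does not affect integrability. *)
set (f' := fun x => if Rlt_dec a x then if Rlt_dec x b then f x else 0 else 0).
assert (hf' : forall x, a < x < b -> f' x = f x).
{ intros x hx; unfold f'; repeat destruct Rlt_dec; lra. }
apply (ex_RInt_ext f').
{ rewrite Rmin_left, Rmax_right by lra; exact hf'. }
apply ex_RInt_Reals_1, (Riemann_integrable_bounded_continuous f' a b K hab).
- intros x hx; apply (continuous_ext_loc _ f); [ | now apply hcont].
  apply (locally_interval _ x a b); try apply hx.
  intros y hy1 hy2; symmetry; now apply hf'.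
- intros x _; unfold f'; destruct Rlt_dec; [destruct Rlt_dec | ];
    try (rewrite Rabs_R0; lra); now apply hK.
Qed.

(** * Uniform limits at infinity *)

(** The endpoints are left out because derivatives are controlled only inside the channel. The class
    is closed under the algebra below and consists of functions integrable over the unit
    interval. *)
Definition bounded_continuous (f : R -> R) : Prop :=
  (forall y, 0 < y < 1 -> continuous f y) /\
  exists K, forall y, 0 < y < 1 -> Rabs (f y) <= K.

Lemma bounded_continuous_const (k : R) : bounded_continuous (fun _ => k).
Proof.
split; [intros; apply continuous_const | exists (Rabs k); intros; lra].
Qed.

Lemma bounded_continuous_plus (f g : R -> R) :
  bounded_continuous f -> bounded_continuous g ->
  bounded_continuous (fun y => f y + g y).
Proof.
intros [cf [K hK]] [cg [K' hK']]; split.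
- intros y hy; apply (continuous_plus f g); auto.
- exists (K + K'); intros y hy; apply Rle_trans with (1 := Rabs_triang _ _).
  apply Rplus_le_compat; auto.
Qed.

Lemma bounded_continuous_mult (f g : R -> R) :
  bounded_continuous f -> bounded_continuous g ->
  bounded_continuous (fun y => f y * g y).
Proof.
intros [cf [K hK]] [cg [K' hK']]; split.
- intros y hy; apply (continuous_mult (K := R_AbsRing) f g); auto.
- exists (K * K'); intros y hy; rewrite Rabs_mult.
  apply Rmult_le_compat; auto using Rabs_pos.
Qed.

Lemma bounded_continuous_opp (f : R -> R) :
  bounded_continuous f -> bounded_continuous (fun y => - f y).
Proof.
intros [cf [K hK]]; split.
- intros y hy; apply (continuous_opp f); auto.
- exists K; intros y hy; rewrite Rabs_Ropp; auto.
Qed.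

Lemma bounded_continuous_inv (f : R -> R) (m : R) :
  0 < m -> (forall y, 0 < y < 1 -> m <= Rabs (f y)) ->
  bounded_continuous f -> bounded_continuous (fun y => / f y).
Proof.
intros hm hf [cf _]; split.
- intros y hy; apply continuous_Rinv_comp; [now apply cf | ].
  intros h0; specialize (hf y hy); rewrite h0, Rabs_R0 in hf; lra.
- exists (/ m); intros y hy; rewrite Rabs_inv; apply Rinv_le_contravar; auto.
Qed.

Lemma locally_open_unit_interval (P : R -> Prop) (y : R) :
  0 < y < 1 -> (forall z, 0 < z < 1 -> P z) -> locally y P.
Proof.
intros hy hP; apply (locally_interval _ y 0 1); try apply hy.
intros z h0 h1; now apply hP.
Qed.

Lemma bounded_continuous_ext (f g : R -> R) :
  (forall y, 0 < y < 1 -> f y = g y) ->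
  bounded_continuous f -> bounded_continuous g.
Proof.
intros hfg [cf [K hK]]; split.
- intros y hy; apply (continuous_ext_loc _ f); [ | now apply cf].
  now apply locally_open_unit_interval.
- exists K; intros y hy; rewrite <- hfg; auto.
Qed.

Lemma bounded_continuous_ex_RInt (f : R -> R) :
  bounded_continuous f -> ex_RInt f 0 1.
Proof.
intros [cf [K hK]]; apply (ex_RInt_bounded_continuous f 0 1 K); auto; lra.
Qed.

(** One filter handles both ends, since the decay estimate depends on xi only through its absolute
    value. *)
Definition at_infinity (P : R -> Prop) : Prop :=
  exists X, forall xi, X < Rabs xi -> P xi.

Global Instance at_infinity_filter : Filter at_infinity.
Proof.
split.
- exists 0; auto.
- intros P Q [X hX] [Y hY]; exists (Rmax X Y); intros xi hxi.
  assert (h1 := Rmax_l X Y); assert (h2 := Rmax_r X Y).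
  split; [apply hX | apply hY]; lra.
- intros P Q hPQ [X hX]; exists X; auto.
Qed.

(** Boundedness and continuity are carried along so that products converge and integrals exist. For
    [F xi] they are asked only eventually, because the denominators are controlled only for large
    |xi|. *)
Definition unif_lim (F : R -> R -> R) (f : R -> R) : Prop :=
  bounded_continuous f /\
  at_infinity (fun xi => bounded_continuous (F xi)) /\
  forall eps, 0 < eps ->
    at_infinity (fun xi => forall y, 0 < y < 1 -> Rabs (F xi y - f y) < eps).

Lemma unif_lim_const (f : R -> R) :
  bounded_continuous f -> unif_lim (fun _ => f) f.
Proof.
intros hf; split; [exact hf | split].
- exists 0; intros; exact hf.
- intros eps heps; exists 0; intros; rewrite Rminus_diag, Rabs_R0; lra.
Qed.

Lemma unif_lim_plus (F G : R -> R -> R) (f g : R -> R) :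
  unif_lim F f -> unif_lim G g ->
  unif_lim (fun xi y => F xi y + G xi y) (fun y => f y + g y).
Proof.
intros [bf [bF hF]] [bg [bG hG]]; split; [ | split].
- now apply bounded_continuous_plus.
- generalize (filter_and (F := at_infinity) _ _ bF bG); apply filter_imp; intros xi [h1 h2].
  now apply bounded_continuous_plus.
- intros eps heps.
  generalize (filter_and (F := at_infinity) _ _ (hF (eps / 2) ltac:(lra)) (hG (eps / 2) ltac:(lra))).
  apply filter_imp; intros xi [h1 h2] y hy.
  specialize (h1 y hy); specialize (h2 y hy).
  replace (F xi y + G xi y - (f y + g y))
    with ((F xi y - f y) + (G xi y - g y)) by ring.
  apply Rle_lt_trans with (1 := Rabs_triang _ _); lra.
Qed.

Lemma unif_lim_opp (F : R -> R -> R) (f : R -> R) :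
  unif_lim F f -> unif_lim (fun xi y => - F xi y) (fun y => - f y).
Proof.
intros [bf [bF hF]]; split; [ | split].
- now apply bounded_continuous_opp.
- generalize bF; apply filter_imp; intros xi; apply bounded_continuous_opp.
- intros eps heps; generalize (hF eps heps); apply filter_imp.
  intros xi h y hy; replace (- F xi y - - f y) with (- (F xi y - f y)) by ring.
  rewrite Rabs_Ropp; auto.
Qed.

Lemma unif_lim_mult (F G : R -> R -> R) (f g : R -> R) :
  unif_lim F f -> unif_lim G g ->
  unif_lim (fun xi y => F xi y * G xi y) (fun y => f y * g y).
Proof.
intros [bf [bF hF]] [bg [bG hG]]; split; [ | split].
- now apply bounded_continuous_mult.
- generalize (filter_and (F := at_infinity) _ _ bF bG); apply filter_imp; intros xi [h1 h2].
  now apply bounded_continuous_mult.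
- intros eps heps.
  destruct bf as [_ [K hK]], bg as [_ [K' hK']].
  assert (hK0 : 0 <= K).
  { apply Rle_trans with (2 := hK (1 / 2) ltac:(lra)); apply Rabs_pos. }
  assert (hK0' : 0 <= K').
  { apply Rle_trans with (2 := hK' (1 / 2) ltac:(lra)); apply Rabs_pos. }
  (* With both errors below [e] and [e] at most 1, the three terms of the decomposition below add up
     to at most [e * (1 + K + K')]. *)
  set (e := Rmin 1 (eps / (K + K' + 2))).
  assert (he : 0 < e).
  { apply Rmin_pos; [lra | apply Rdiv_lt_0_compat; lra]. }
  assert (he1 : e <= 1) by apply Rmin_l.
  assert (he2 : e * (K + K' + 2) <= eps).
  { apply Rle_div_r; [lra | apply Rmin_r]. }
  generalize (filter_and (F := at_infinity) _ _ (hF e he) (hG e he)).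
  apply filter_imp; intros xi [h1 h2] y hy.
  specialize (h1 y hy); specialize (h2 y hy).
  specialize (hK y hy); specialize (hK' y hy).
  replace (F xi y * G xi y - f y * g y)
    with ((F xi y - f y) * (G xi y - g y) + f y * (G xi y - g y)
          + (F xi y - f y) * g y) by ring.
  apply Rle_lt_trans with (1 := Rabs_triang _ _).
  apply Rle_lt_trans with (1 := Rplus_le_compat_r _ _ _ (Rabs_triang _ _)).
  rewrite !Rabs_mult.
  assert (p1 := Rabs_pos (F xi y - f y)); assert (p2 := Rabs_pos (G xi y - g y)).
  assert (p3 := Rabs_pos (f y)); assert (p4 := Rabs_pos (g y)).
  nra.
Qed.

Lemma unif_lim_inv (F : R -> R -> R) (f : R -> R) (m : R) :
  0 < m -> (forall y, 0 < y < 1 -> m <= Rabs (f y)) ->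
  unif_lim F f -> unif_lim (fun xi y => / F xi y) (fun y => / f y).
Proof.
intros hm hf [bf [bF hF]].
(* Once the error is less than [m / 2], half of the lower bound survives for [F xi]. *)
assert (hF2 : at_infinity (fun xi => forall y, 0 < y < 1 -> m / 2 <= Rabs (F xi y))).
{ generalize (hF (m / 2) ltac:(lra)); apply filter_imp; intros xi h y hy.
  specialize (h y hy); specialize (hf y hy).
  assert (h1 := Rabs_triang_inv (f y) (F xi y)).
  rewrite Rabs_minus_sym in h1; lra. }
split; [ | split].
- now apply (bounded_continuous_inv _ m).
- generalize (filter_and (F := at_infinity) _ _ bF hF2); apply filter_imp; intros xi [h1 h2].
  apply (bounded_continuous_inv _ (m / 2)); auto; lra.
- intros eps heps.
  (* The reciprocals differ by |F - f| / |F f|, whose denominator is at least [m * m / 2]. *)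
  assert (heps' : 0 < eps * (m * m / 2)) by (apply Rmult_lt_0_compat; nra).
  generalize (filter_and (F := at_infinity) _ _ (hF _ heps') hF2).
  apply filter_imp; intros xi [h1 h2] y hy.
  specialize (h1 y hy); specialize (h2 y hy); specialize (hf y hy).
  assert (f y <> 0) by (intros h; rewrite h, Rabs_R0 in hf; lra).
  assert (F xi y <> 0) by (intros h; rewrite h, Rabs_R0 in h2; lra).
  replace (/ F xi y - / f y) with (- (F xi y - f y) / (F xi y * f y))
    by (field; auto).
  unfold Rdiv; rewrite Rabs_mult, Rabs_inv, Rabs_Ropp, Rabs_mult.
  assert (hm2 : m * m / 2 <= Rabs (F xi y) * Rabs (f y)) by nra.
  apply Rlt_div_l; [nra | ].
  apply Rlt_le_trans with (1 := h1), Rmult_le_compat_l; lra.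
Qed.

Lemma unif_lim_ext (F G : R -> R -> R) (f g : R -> R) :
  (forall xi y, 0 < y < 1 -> F xi y = G xi y) ->
  (forall y, 0 < y < 1 -> f y = g y) ->
  unif_lim F f -> unif_lim G g.
Proof.
intros hFG hfg [bf [bF hF]]; split; [ | split].
- now apply (bounded_continuous_ext f).
- generalize bF; apply filter_imp; intros xi.
  apply bounded_continuous_ext; auto.
- intros eps heps; generalize (hF eps heps); apply filter_imp.
  intros xi h y hy; rewrite <- hFG, <- hfg; auto.
Qed.

Lemma unif_lim_exp_decay (F : R -> R -> R) (f : R -> R) (C1 C2 : R) :
  0 < C1 -> 0 < C2 -> bounded_continuous f ->
  (forall xi y, 0 < y < 1 -> continuous (F xi) y) ->
  (forall xi y, 0 < y < 1 -> Rabs (F xi y - f y) <= C1 * exp (- C2 * Rabs xi)) ->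
  unif_lim F f.
Proof.
intros h1 h2 bf cF hF; split; [exact bf | split].
- exists 0; intros xi _; split; [auto | ].
  destruct bf as [_ [K hK]]; exists (C1 * exp (- C2 * Rabs xi) + K).
  intros y hy; replace (F xi y) with ((F xi y - f y) + f y) by ring.
  apply Rle_trans with (1 := Rabs_triang _ _).
  apply Rplus_le_compat; auto.
(* Past this threshold [C1] is less than [eps * (C2 * Rabs xi)], hence less than
   [eps * exp (C2 * Rabs xi)] because exp t is at least 1 + t. *)
- intros eps heps; exists (C1 / (eps * C2)); intros xi hxi y hy.
  apply Rle_lt_trans with (1 := hF xi y hy).
  replace (- C2 * Rabs xi) with (- (C2 * Rabs xi)) by ring.
  rewrite exp_Ropp.
  assert (hx : C1 < eps * (C2 * Rabs xi)).
  { apply Rlt_div_l in hxi; [lra | nra]. }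
  assert (he := exp_ineq1_le (C2 * Rabs xi)).
  apply Rlt_div_l; [apply exp_pos | nra].
Qed.

Lemma unif_lim_RInt (F : R -> R -> R) (f : R -> R) :
  unif_lim F f ->
  filterlim (fun xi => RInt (F xi) 0 1) at_infinity (locally (RInt f 0 1)).
Proof.
intros [bf [bF hF]]; apply filterlim_locally; intros eps.
assert (heps := cond_pos eps).
generalize (filter_and (F := at_infinity) _ _ bF (hF (eps / 2) ltac:(lra))); apply filter_imp.
intros xi [h1 h2].
apply bounded_continuous_ex_RInt in bf; apply bounded_continuous_ex_RInt in h1.
change (Rabs (RInt (F xi) 0 1 - RInt f 0 1) < eps).
rewrite <- (RInt_minus (V := R_CompleteNormedModule)) by assumption.
(* [abs_RInt_le_const] asks for a bound on the closed interval, so the difference is set to 0 at the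
   ends. *)
set (d := fun y => if Rlt_dec 0 y then if Rlt_dec y 1 then F xi y - f y else 0
                   else 0).
assert (hd : forall y, 0 < y < 1 -> d y = F xi y - f y).
{ intros y hy; unfold d; repeat destruct Rlt_dec; lra. }
assert (ed : ex_RInt d 0 1).
{ apply (ex_RInt_ext (fun y => minus (F xi y) (f y))).
  - rewrite Rmin_left, Rmax_right by lra; intros y hy; now rewrite hd.
  - apply (ex_RInt_minus (V := R_NormedModule)); assumption. }
rewrite (RInt_ext _ d).
- apply Rle_lt_trans with ((1 - 0) * (eps / 2)); [ | lra].
  apply abs_RInt_le_const; [lra | exact ed | ].
  intros y _; unfold d; repeat destruct Rlt_dec; try (rewrite Rabs_R0; lra).
  left; apply h2; lra.
- rewrite Rmin_left, Rmax_right by lra; intros y hy; now rewrite hd.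
Qed.

(** * Uniform limits of complex-valued functions *)

Definition unif_lim_C (F : R -> R -> C) (f : R -> C) : Prop :=
  unif_lim (fun xi y => fst (F xi y)) (fun y => fst (f y)) /\
  unif_lim (fun xi y => snd (F xi y)) (fun y => snd (f y)).

Lemma unif_lim_RtoC (F : R -> R -> R) (f : R -> R) :
  unif_lim F f -> unif_lim_C (fun xi y => RtoC (F xi y)) (fun y => RtoC (f y)).
Proof.
intros h; split; [exact h | apply (unif_lim_const (fun _ => 0)), bounded_continuous_const].
Qed.

Lemma unif_lim_C_const (k : C) : unif_lim_C (fun _ _ => k) (fun _ => k).
Proof.
split; [apply (unif_lim_const (fun _ => fst k)) | apply (unif_lim_const (fun _ => snd k))];
  apply bounded_continuous_const.
Qed.

Lemma unif_lim_C_plus (F G : R -> R -> C) (f g : R -> C) :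
  unif_lim_C F f -> unif_lim_C G g ->
  unif_lim_C (fun xi y => (F xi y + G xi y)%C) (fun y => (f y + g y)%C).
Proof.
intros [hF1 hF2] [hG1 hG2]; split; simpl; now apply unif_lim_plus.
Qed.

Lemma unif_lim_C_opp (F : R -> R -> C) (f : R -> C) :
  unif_lim_C F f -> unif_lim_C (fun xi y => (- F xi y)%C) (fun y => (- f y)%C).
Proof. intros [hF1 hF2]; split; simpl; now apply unif_lim_opp. Qed.

Lemma unif_lim_C_mult (F G : R -> R -> C) (f g : R -> C) :
  unif_lim_C F f -> unif_lim_C G g ->
  unif_lim_C (fun xi y => (F xi y * G xi y)%C) (fun y => (f y * g y)%C).
Proof.
intros [hF1 hF2] [hG1 hG2]; split; simpl;
  repeat first [apply unif_lim_plus | apply unif_lim_opp | apply unif_lim_mult];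
  assumption.
Qed.

(** The inverse is the conjugate over the squared modulus, which reduces the claim to a real
    reciprocal. *)
Lemma unif_lim_C_inv (F : R -> R -> C) (f : R -> C) (m : R) :
  0 < m -> (forall y, 0 < y < 1 -> m <= fst (f y) ^ 2 + snd (f y) ^ 2) ->
  unif_lim_C F f -> unif_lim_C (fun xi y => (/ F xi y)%C) (fun y => (/ f y)%C).
Proof.
intros hm hf [hF1 hF2].
assert (h : unif_lim (fun xi y => / (fst (F xi y) ^ 2 + snd (F xi y) ^ 2))
                     (fun y => / (fst (f y) ^ 2 + snd (f y) ^ 2))).
{ apply unif_lim_inv with m; auto.
  - intros y hy; apply Rle_trans with (1 := hf y hy), Rle_abs.
  - simpl; apply unif_lim_plus; repeat apply unif_lim_mult; try assumption;
      apply unif_lim_const, bounded_continuous_const. }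
split; simpl; apply unif_lim_mult; try apply unif_lim_opp; assumption.
Qed.

Lemma unif_lim_C_ext (F G : R -> R -> C) (f g : R -> C) :
  (forall xi y, 0 < y < 1 -> F xi y = G xi y) ->
  (forall y, 0 < y < 1 -> f y = g y) ->
  unif_lim_C F f -> unif_lim_C G g.
Proof.
intros hFG hfg [h1 h2]; split.
- revert h1; apply unif_lim_ext; intros; f_equal; auto.
- revert h2; apply unif_lim_ext; intros; f_equal; auto.
Qed.

Lemma RInt_C (f : R -> C) :
  ex_RInt (fun y => fst (f y)) 0 1 -> ex_RInt (fun y => snd (f y)) 0 1 ->
  RInt (V := C_R_CompleteNormedModule) f 0 1
    = (RInt (fun y => fst (f y)) 0 1, RInt (fun y => snd (f y)) 0 1).
Proof.
intros h1 h2; apply (is_RInt_unique (V := C_R_CompleteNormedModule)).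
apply (is_RInt_fct_extend_pair (U := R_NormedModule) (V := R_NormedModule));
  now apply (RInt_correct (V := R_CompleteNormedModule)).
Qed.

Lemma unif_lim_C_RInt (F : R -> R -> C) (f : R -> C) :
  unif_lim_C F f ->
  filterlim (fun xi => RInt (V := C_R_CompleteNormedModule) (F xi) 0 1)
    at_infinity (locally (RInt (V := C_R_CompleteNormedModule) f 0 1 : C)).
Proof.
intros [hF1 hF2].
assert (hl1 := unif_lim_RInt _ _ hF1); assert (hl2 := unif_lim_RInt _ _ hF2).
destruct hF1 as [bf1 [bF1 _]], hF2 as [bf2 [bF2 _]].
rewrite (RInt_C f) by now apply bounded_continuous_ex_RInt.
(* The integral is known to split into components only for large |xi|, where [F xi] is
   integrable. *)
apply (filterlim_ext_loc
  (fun xi => (RInt (fun y => fst (F xi y)) 0 1, RInt (fun y => snd (F xi y)) 0 1))).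
- generalize (filter_and (F := at_infinity) _ _ bF1 bF2); apply filter_imp; intros xi [h1 h2].
  symmetry; apply RInt_C; now apply bounded_continuous_ex_RInt.
- apply (filterlim_locally (U := C_UniformSpace) (F := at_infinity)); intros eps.
  rewrite filterlim_locally in hl1, hl2.
  generalize (filter_and (F := at_infinity) _ _ (hl1 eps) (hl2 eps)); apply filter_imp.
  intros xi [h1 h2]; now split.
Qed.

(** * Regularity of the eigenfunctions *)

Lemma rhobar_bounds (delta y : R) :
  0 < delta -> 0 < y < 1 -> exp (- delta) <= rhobar delta y <= 1.
Proof.
intros hd hy; unfold rhobar; split.
- apply Rnot_lt_le; intros h; apply exp_lt_inv in h; nra.
- rewrite <- exp_0; apply Rnot_lt_le; intros h; apply exp_lt_inv in h; nra.
Qed.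

Lemma is_derive_rhobar (delta y : R) :
  is_derive (rhobar delta) y (- delta * rhobar delta y).
Proof. unfold rhobar; auto_derive; [easy | ring]. Qed.

Lemma Derive_rhobar (delta y : R) :
  Derive (rhobar delta) y = - delta * rhobar delta y.
Proof. apply is_derive_unique, is_derive_rhobar. Qed.

Lemma bounded_continuous_rhobar (delta : R) :
  0 < delta -> bounded_continuous (rhobar delta).
Proof.
intros hd; split.
- intros y _; apply (ex_derive_continuous (rhobar delta)).
  eexists; apply is_derive_rhobar.
- exists 1; intros y hy; assert (h := rhobar_bounds delta y hd hy).
  assert (h' := exp_pos (- delta)); rewrite Rabs_pos_eq; lra.
Qed.

(** Continuity is only one-sided at 0 and 1, so [f] is composed with a clamp, giving a function
    continuous on the whole line, before the extreme value theorem is applied. *)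
Lemma continuous_on_unit_interval_bounded (f : R -> R) :
  continuous_on (fun y => 0 <= y <= 1) f ->
  exists K, forall y, 0 <= y <= 1 -> Rabs (f y) <= K.
Proof.
intros hf.
set (clamp := fun y => Rmax 0 (Rmin 1 y)).
assert (hc : forall y, 0 <= clamp y <= 1).
{ intros y; unfold clamp, Rmax, Rmin; repeat destruct Rle_dec; lra. }
assert (hid : forall y, 0 <= y <= 1 -> clamp y = y).
{ intros y hy; unfold clamp, Rmax, Rmin; repeat destruct Rle_dec; lra. }
assert (hcont : forall y, continuity_pt (fun z => Rabs (f (clamp z))) y).
{ intros y; apply continuity_pt_filterlim, (continuous_comp (fun z => f (clamp z)) Rabs).
  - apply filterlim_comp with (2 := hf (clamp y) (hc y)).
    intros P hP; unfold within in hP.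
    refine (filter_imp (fun z => 0 <= clamp z <= 1 -> P (clamp z)) _ _
      (continuous_clamp 0 1 y _ hP)).
    intros z hz; exact (hz (hc z)).
  - apply continuous_Rabs. }
destruct (continuity_ab_maj (fun z => Rabs (f (clamp z))) 0 1) as [M [hM _]].
- lra.
- auto.
- exists (Rabs (f (clamp M))); intros y hy.
  specialize (hM y hy); simpl in hM; now rewrite (hid y hy) in hM.
Qed.

(** The mean value theorem is applied from the base point 1/2, so that the endpoints never enter. *)
Lemma bounded_derivative_bounded (f df : R -> R) (K : R) :
  (forall y, 0 < y < 1 -> is_derive f y (df y)) ->
  (forall y, 0 < y < 1 -> Rabs (df y) <= K) ->
  bounded_continuous f.
Proof.
intros hdf hK; split.
- intros y hy; apply (ex_derive_continuous f); eexists; now apply hdf.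
- exists (K + Rabs (f (1 / 2))); intros y hy.
  destruct (MVT_gen f (1 / 2) y df) as [z [hz heq]].
  + intros x hx; apply hdf; revert hx; unfold Rmin, Rmax; destruct Rle_dec; lra.
  + intros x hx; apply continuity_pt_filterlim, (ex_derive_continuous f).
    eexists; apply hdf; revert hx; unfold Rmin, Rmax; destruct Rle_dec; lra.
  + replace (f y) with ((f y - f (1 / 2)) + f (1 / 2)) by ring.
    apply Rle_trans with (1 := Rabs_triang _ _), Rplus_le_compat_r.
    rewrite heq, Rabs_mult.
    assert (hz' : 0 < z < 1)
      by (revert hz; unfold Rmin, Rmax; destruct Rle_dec; lra).
    specialize (hK z hz').
    assert (Rabs (y - 1 / 2) <= 1) by (apply Rabs_le; lra).
    assert (h1 := Rabs_pos (df z)); assert (h2 := Rabs_pos (y - 1 / 2)); nra.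
Qed.

Definition bounded_derivatives (n : nat) (f : R -> R) : Prop :=
  forall k, (k <= n)%nat -> bounded_continuous (Derive_n f k).

(** The equation only gives the derivative of the flux [rhobar * chi']. Dividing the flux by
    [rhobar], the quotient rule and rhobar' = - delta rhobar yield chi''. *)
Lemma is_derive_eigenfunction (delta mu : R) (chi : R -> R) (y : R) :
  eigenfunction delta mu chi -> 0 < y < 1 ->
  is_derive (Derive chi) y (delta * (Derive chi y - mu * chi y)).
Proof.
intros [_ [_ [_ [_ hchi]]]] hy; destruct (hchi y hy) as [_ hd].
assert (hr : forall z, rhobar delta z <> 0).
{ intros z; apply Rgt_not_eq, exp_pos. }
apply (is_derive_ext
  (fun z => (rhobar delta z * Derive chi z) / rhobar delta z)).
{ intros z; change (rhobar delta z * Derive chi z / rhobar delta z = Derive chi z).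
  field; apply hr. }
replace (delta * (Derive chi y - mu * chi y))
  with ((mu * Derive (rhobar delta) y * chi y * rhobar delta y
         - (rhobar delta y * Derive chi y) * (- delta * rhobar delta y))
        / rhobar delta y ^ 2).
- apply (is_derive_div (fun z => rhobar delta z * Derive chi z) (rhobar delta));
    [exact hd | apply is_derive_rhobar | apply hr].
- rewrite Derive_rhobar; field; apply hr.
Qed.

(** The two values of [k] reach order 3, the highest order in S_2. The case 1 comes from
    differentiating the case 0, which holds throughout the open interval. *)
Lemma Derive_n_eigenfunction (delta mu : R) (chi : R -> R) (k : nat) (y : R) :
  eigenfunction delta mu chi -> 0 < y < 1 -> (k <= 1)%nat ->
  Derive_n chi (S (S k)) y = delta * (Derive_n chi (S k) y - mu * Derive_n chi k y).
Proof.
intros he hy hk.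
assert (h2 : forall z, 0 < z < 1 ->
  Derive_n chi 2 z = delta * (Derive_n chi 1 z - mu * chi z)).
{ intros z hz; apply is_derive_unique.
  now apply (is_derive_eigenfunction delta mu). }
destruct k as [ | [ | k]]; [now apply h2 | | lia].
simpl; rewrite (Derive_ext_loc _ (fun z => delta * (Derive_n chi 1 z - mu * chi z))).
- assert (h1 := is_derive_eigenfunction delta mu chi y he hy).
  destruct he as [_ [_ [_ [_ hchi]]]]; destruct (hchi y hy) as [ec _].
  change (Derive_n chi 1) with (Derive chi).
  rewrite Derive_scal, Derive_minus, Derive_scal; trivial.
  + eexists; exact h1.
  + now apply (ex_derive_scal chi).
- now apply locally_open_unit_interval.
Qed.

(** Compactness bounds [chi]. The flux [rhobar * chi'] then has a bounded derivative, so it is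
    bounded, and so is chi' because [rhobar] is at least [exp (- delta)]. The differential equation
    passes boundedness and continuity on to orders 2 and 3. *)
Lemma eigenfunction_bounded_derivatives (delta mu : R) (chi : R -> R) :
  0 < delta -> eigenfunction delta mu chi -> bounded_derivatives 3 chi.
Proof.
intros hd he.
assert (br := bounded_continuous_rhobar delta hd).
assert (b0 : bounded_continuous chi).
{ destruct he as [hc [_ [_ [_ hchi]]]]; split.
  - intros y hy; apply (ex_derive_continuous chi), (hchi y hy).
  - destruct (continuous_on_unit_interval_bounded chi hc) as [K hK].
    exists K; intros y hy; apply hK; lra. }
assert (b1 : bounded_continuous (Derive chi)).
{ assert (bflux : bounded_continuous (fun y => rhobar delta y * Derive chi y)).
  { assert (bdf : bounded_continuous
      (fun y => mu * (- delta * rhobar delta y) * chi y)).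
    { repeat apply bounded_continuous_mult; trivial;
        apply bounded_continuous_const. }
    destruct bdf as [_ [K hK]]; destruct he as [_ [_ [_ [_ hchi]]]].
    apply (bounded_derivative_bounded _
      (fun y => mu * (- delta * rhobar delta y) * chi y) K); trivial.
    intros y hy; rewrite <- Derive_rhobar; now apply hchi. }
  apply (bounded_continuous_ext
    (fun y => (rhobar delta y * Derive chi y) * / rhobar delta y)).
  - intros y _; field; apply Rgt_not_eq, exp_pos.
  - apply bounded_continuous_mult; trivial.
    apply (bounded_continuous_inv _ (exp (- delta))); trivial; [apply exp_pos | ].
    intros y hy; apply Rle_trans with (2 := Rle_abs _).
    now apply rhobar_bounds. }
assert (hrec : forall k, (k <= 1)%nat ->
  bounded_continuous (Derive_n chi k) ->
  bounded_continuous (Derive_n chi (S k)) ->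
  bounded_continuous (Derive_n chi (S (S k)))).
{ intros k hk bk bSk.
  apply (bounded_continuous_ext
    (fun y => delta * (Derive_n chi (S k) y + - (mu * Derive_n chi k y)))).
  - intros y hy; symmetry; now apply (Derive_n_eigenfunction delta mu).
  - apply bounded_continuous_mult; [apply bounded_continuous_const | ].
    apply bounded_continuous_plus; trivial; apply bounded_continuous_opp.
    apply bounded_continuous_mult; trivial; apply bounded_continuous_const. }
assert (b2 := hrec 0%nat ltac:(lia) b0 b1).
assert (b3 := hrec 1%nat ltac:(lia) b1 b2).
intros [ | [ | [ | [ | k]]]] hk; trivial; lia.
Qed.

Lemma bounded_derivatives_Derive_rhobar_mult (delta : R) (chi : R -> R) :
  0 < delta -> bounded_derivatives 1 chi ->
  (forall y, 0 < y < 1 -> ex_derive chi y) ->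
  bounded_derivatives 1 (fun y => Derive (rhobar delta) y * chi y).
Proof.
intros hd bchi dchi.
assert (br := bounded_continuous_rhobar delta hd).
assert (b0 := bchi 0%nat ltac:(lia)); assert (b1 := bchi 1%nat ltac:(lia)).
intros [ | [ | k]] hk; [ | | lia].
- apply (bounded_continuous_ext (fun y => - delta * rhobar delta y * chi y)).
  + intros y _; simpl; now rewrite Derive_rhobar.
  + repeat apply bounded_continuous_mult; trivial; apply bounded_continuous_const.
- apply (bounded_continuous_ext
    (fun y => (- delta * (- delta * rhobar delta y)) * chi y
              + - delta * rhobar delta y * Derive chi y)).
  + intros y hy; symmetry; simpl.
    rewrite (Derive_ext _ (fun z => - delta * rhobar delta z * chi z))
      by (intros; now rewrite Derive_rhobar).
    apply is_derive_unique.
    apply (is_derive_mult (fun z => - delta * rhobar delta z) chi).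
    * apply is_derive_scal, is_derive_rhobar.
    * now apply Derive_correct, dchi.
    * intros; apply Rmult_comm.
  + apply bounded_continuous_plus; repeat apply bounded_continuous_mult; trivial;
      apply bounded_continuous_const.
Qed.

(** * Decay of the solitary wave *)

Lemma partial_derive_ext_strip (F G : R -> R -> R) (a b : nat) (xi y : R) :
  (forall s z, 0 < z < 1 -> F s z = G s z) -> 0 < y < 1 ->
  partial_derive a b F xi y = partial_derive a b G xi y.
Proof.
intros hFG hy; apply Derive_n_ext; intros s; apply Derive_n_ext_loc.
apply locally_open_unit_interval; auto.
Qed.

Lemma partial_derive_continuous (F : R -> R -> R) (a b n : nat) (xi y : R) :
  (a + b <= n)%nat -> ex_diff_n F n xi y ->
  continuous (partial_derive a b F xi) y.
Proof.
intros hab hF; apply (ex_diff_n_deriv _ _ _ hab) in hF.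
assert (h : continuity_2d_pt (partial_derive a b F) xi y)
  by (destruct (n - (a + b))%nat; apply hF).
apply continuity_2d_pt_filterlim in h.
apply filterlim_comp with (f := fun z => (xi, z)) (2 := h).
intros P [eps hP]; exists eps; intros z hz; apply hP.
split; [apply ball_center | exact hz].
Qed.

(** The quiescent velocities vanish, so one statement serves both u and v; the [- 0] is the shape
    that (A2) takes for them. *)
Lemma unif_lim_velocity (f : R -> R -> R) (C1 C2 : R) (a b : nat) :
  0 < C1 -> 0 < C2 -> (a + b <= 3)%nat ->
  (forall xi y, 0 < y < 1 -> ex_diff_n f 3 xi y) ->
  (forall (a b : nat) xi y, (a + b <= 3)%nat -> 0 < y < 1 ->
     Rabs (partial_derive a b (fun s z => f s z - 0) xi y)
       <= C1 * exp (- C2 * Rabs xi)) ->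
  unif_lim (partial_derive a b f) (fun _ => 0).
Proof.
intros h1 h2 hab hf hdecay.
apply (unif_lim_exp_decay _ _ C1 C2); trivial.
- apply bounded_continuous_const.
- intros xi y hy; now apply (partial_derive_continuous f a b 3); auto.
- intros xi y hy; rewrite Rminus_0_r.
  rewrite (partial_derive_ext_strip f (fun s z => f s z - 0)); auto.
  intros; ring.
Qed.

(** [partial_derive] takes the y-derivatives first, so the innermost one turns psi into u and no
    interchange of derivatives is involved. *)
Lemma partial_derive_stream_y (U : profile) (psi : R -> R -> R) (a b : nat)
    (xi y : R) :
  stream_function U psi -> 0 < y < 1 ->
  partial_derive a (S b) psi xi y = partial_derive a b (vel_u U) xi y.
Proof.
intros [_ [hpsi _]] hy; apply Derive_n_ext; intros s.
replace (S b) with (b + 1)%nat by lia; rewrite <- Derive_n_comp.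
apply Derive_n_ext_loc, locally_open_unit_interval; trivial.
intros z hz; apply is_derive_unique, hpsi, hz.
Qed.

Lemma partial_derive_stream_x (U : profile) (psi : R -> R -> R) (a : nat)
    (xi y : R) :
  stream_function U psi -> 0 < y < 1 ->
  partial_derive (S a) 0 psi xi y = - partial_derive a 0 (vel_v U) xi y.
Proof.
intros [_ [hpsi _]] hy; unfold partial_derive.
rewrite <- Derive_n_opp; replace (S a) with (a + 1)%nat by lia.
rewrite <- Derive_n_comp; apply Derive_n_ext; intros s.
apply is_derive_unique, hpsi, hy.
Qed.

Section DecayAtInfinity.
Context (g delta c : R) (U : profile) (psi : R -> R -> R).
Hypotheses (hdelta : 0 < delta) (hU : regular_isw g delta c U)
  (hpsi : stream_function U psi).

Lemma unif_lim_stream (a b : nat) :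
  (1 <= a + b <= 3)%nat -> unif_lim_C (pd a b psi) (fun _ => RtoC 0).
Proof.
intros hab; apply unif_lim_RtoC.
destruct hU as [_ [hreg [[C1 [C2 [h1 [h2 [_ [hu [hv _]]]]]]] _]]].
(* A derivative of psi is a velocity derivative of one order less: of - v if no y-derivative is
   taken, of u otherwise. *)
destruct b as [ | b]; [destruct a as [ | a]; [lia | ] | ].
- apply (unif_lim_ext (fun xi y => - partial_derive a 0 (vel_v U) xi y) _
    (fun _ => - 0)).
  + intros xi y hy; symmetry; now apply partial_derive_stream_x.
  + intros; ring.
  + apply unif_lim_opp, (unif_lim_velocity _ C1 C2); trivial; [lia | ].
    intros xi y hy; now apply hreg.
- apply (unif_lim_ext (partial_derive a b (vel_u U)) _ (fun _ => 0)); trivial.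
  + intros xi y hy; symmetry; now apply partial_derive_stream_y.
  + apply (unif_lim_velocity _ C1 C2); trivial; [lia | ].
    intros xi y hy; now apply hreg.
Qed.

Lemma unif_lim_density :
  unif_lim_C (fun xi y => RtoC (rho U xi y)) (fun y => RtoC (rhobar delta y)).
Proof.
apply unif_lim_RtoC.
destruct hU as [_ [hreg [[C1 [C2 [h1 [h2 [hr _]]]]] _]]].
apply (unif_lim_exp_decay _ _ C1 C2); trivial.
- now apply bounded_continuous_rhobar.
- intros xi y hy.
  apply (partial_derive_continuous (rho U) 0 0 3); [lia | now apply hreg].
- intros xi y hy; apply (hr 0%nat 0%nat xi y); trivial; lia.
Qed.

Lemma unif_lim_density_x : unif_lim_C (pd 1 0 (rho U)) (fun _ => RtoC 0).
Proof.
apply unif_lim_RtoC.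
destruct hU as [_ [hreg [[C1 [C2 [h1 [h2 [hr _]]]]] _]]].
apply (unif_lim_exp_decay _ _ C1 C2); trivial.
- apply bounded_continuous_const.
- intros xi y hy.
  apply (partial_derive_continuous (rho U) 1 0 3); [lia | now apply hreg].
(* [rhobar] does not depend on xi, so the quiescent term of the difference disappears. *)
- intros xi y hy; generalize (hr 1%nat 0%nat xi y ltac:(lia) hy).
  unfold partial_derive; simpl; rewrite Derive_minus, Derive_const; trivial.
  + now apply (hreg xi y hy).
  + apply ex_derive_const.
Qed.

Lemma unif_lim_density_y :
  unif_lim_C (pd 0 1 (rho U)) (fun y => RtoC (- delta * rhobar delta y)).
Proof.
apply unif_lim_RtoC.
destruct hU as [_ [hreg [[C1 [C2 [h1 [h2 [hr _]]]]] _]]].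
apply (unif_lim_exp_decay _ _ C1 C2); trivial.
- apply bounded_continuous_mult; [apply bounded_continuous_const | ].
  now apply bounded_continuous_rhobar.
- intros xi y hy.
  apply (partial_derive_continuous (rho U) 0 1 3); [lia | now apply hreg].
- intros xi y hy; generalize (hr 0%nat 1%nat xi y ltac:(lia) hy).
  unfold partial_derive; simpl; rewrite Derive_minus, Derive_rhobar; trivial.
  + now apply (hreg xi y hy).
  + eexists; apply is_derive_rhobar.
Qed.

End DecayAtInfinity.

(** * Limits of the operator entries *)

Lemma dy_RtoC (n : nat) (h : R -> R) (y : R) :
  dy n (fun z => RtoC (h z)) y = RtoC (Derive_n h n y).
Proof.
unfold dy, RtoC; simpl; f_equal.
destruct n as [ | n]; [easy | apply Derive_n_const].
Qed.

Lemma unif_lim_dy (n k : nat) (h : R -> R) :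
  bounded_derivatives n h -> (k <= n)%nat ->
  unif_lim_C (fun _ y => dy k (fun z => RtoC (h z)) y)
             (fun y => RtoC (Derive_n h k y)).
Proof.
intros hh hk; apply (unif_lim_C_ext
  (fun _ y => RtoC (Derive_n h k y)) _ (fun y => RtoC (Derive_n h k y))); trivial.
- intros; now rewrite dy_RtoC.
- now apply unif_lim_RtoC, unif_lim_const, hh.
Qed.

Section OperatorLimits.
Context (g delta c : R) (U : profile) (psi : R -> R -> R).
Hypotheses (hdelta : 0 < delta) (hU : regular_isw g delta c U)
  (hpsi : stream_function U psi).

Lemma speed_neq_0 : RtoC c <> 0.
Proof. intros h; apply RtoC_inj in h; destruct hU as [[hc _] _]; lra. Qed.

Lemma rhobar_neq_0 (y : R) : RtoC (rhobar delta y) <> 0.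
Proof.
intros h; apply RtoC_inj in h; assert (h' := exp_pos (- delta * y)).
unfold rhobar in h; lra.
Qed.

Lemma unif_lim_relative_speed :
  unif_lim_C (fun xi y => (pd 0 1 psi xi y - RtoC c)%C) (fun _ => RtoC (- c)).
Proof.
apply (unif_lim_C_ext (fun xi y => (pd 0 1 psi xi y + - RtoC c)%C) _
  (fun _ => (RtoC 0 + - RtoC c)%C)); trivial.
- intros; rewrite RtoC_opp; ring.
- apply unif_lim_C_plus, unif_lim_C_const.
  apply (unif_lim_stream g delta c U); trivial; lia.
Qed.

Lemma unif_lim_inv_relative_speed :
  unif_lim_C (fun xi y => (/ (pd 0 1 psi xi y - RtoC c))%C)
             (fun _ => (/ RtoC (- c))%C).
Proof.
apply (unif_lim_C_inv _ _ (c ^ 2)).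
- destruct hU as [[hc _] _]; now apply pow_lt.
- intros y _; simpl; lra.
- apply unif_lim_relative_speed.
Qed.

Lemma unif_lim_inv_momentum :
  unif_lim_C (fun xi y => (/ ((pd 0 1 psi xi y - RtoC c) * RtoC (rho U xi y)))%C)
             (fun y => (/ (RtoC (- c) * RtoC (rhobar delta y)))%C).
Proof.
(* The squared modulus of the limit is that of c rhobar, and [rhobar] is at least
   [exp (- delta)]. *)
apply (unif_lim_C_inv _ _ ((c * exp (- delta)) ^ 2)).
- destruct hU as [[hc _] _]; apply pow_lt, Rmult_lt_0_compat; trivial.
  apply exp_pos.
- intros y hy; assert (h := rhobar_bounds delta y hdelta hy).
  assert (h' := exp_pos (- delta)).
  destruct hU as [[hc _] _]; simpl.
  assert (c * exp (- delta) <= c * rhobar delta y)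
    by (apply Rmult_le_compat_l; lra).
  assert (0 < c * exp (- delta)) by now apply Rmult_lt_0_compat.
  nra.
- apply unif_lim_C_mult; [apply unif_lim_relative_speed | ].
  now apply (unif_lim_density g delta c).
Qed.

(** Follows the syntax of an operator entry and builds its limit in an existential variable. The
    order of the cases matters: constants come first, and the inverse of a product, bounded as a
    whole, precedes the other inverses. *)
Ltac unif_lim_C_auto := unfold Cdiv, Cminus; cbn [Cpow]; repeat
  lazymatch goal with
  | |- unif_lim_C (fun _ _ => ?k) _ => apply (unif_lim_C_const k)
  | |- unif_lim_C (fun xi y => Cplus _ _) _ => eapply unif_lim_C_plus
  | |- unif_lim_C (fun xi y => Copp _) _ => eapply unif_lim_C_opp
  | |- unif_lim_C (fun xi y => Cmult _ _) _ => eapply unif_lim_C_mult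
  | |- unif_lim_C (fun xi y => Cinv (Cmult _ _)) _ => apply unif_lim_inv_momentum
  | |- unif_lim_C (fun xi y => Cinv _) _ => apply unif_lim_inv_relative_speed
  | |- unif_lim_C (pd _ _ psi) _ =>
      apply (unif_lim_stream g delta c U psi hU hpsi); lia
  | |- unif_lim_C (pd 1 0 _) _ =>
      apply (unif_lim_density_x g delta c U hU)
  | |- unif_lim_C (pd 0 1 _) _ =>
      apply (unif_lim_density_y g delta c U hdelta hU)
  | |- unif_lim_C (fun xi y => RtoC (rho _ xi y)) _ =>
      apply (unif_lim_density g delta c U hdelta hU)
  | |- unif_lim_C (fun _ y => RtoC (?f y)) _ =>
      apply unif_lim_RtoC, unif_lim_const;
      match goal with hf : bounded_derivatives _ f |- _ => apply (hf 0%nat); lia end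
  | |- unif_lim_C (fun xi y => dy _ _ y) _ =>
      eapply unif_lim_dy; [eassumption | lia]
  end.

(** The limit found by traversal is compared with the stated one by [field]; the terms containing a
    derivative of psi or rho_xi have become 0. *)
Ltac unif_lim_C_op :=
  eapply unif_lim_C_ext; [intros; reflexivity | | solve [unif_lim_C_auto]];
  intros y hy; simpl; rewrite ?RtoC_opp, ?RtoC_mult, ?RtoC_opp;
  field; repeat split; first [apply speed_neq_0 | apply rhobar_neq_0].

Variables (kappa : C) (h : R -> R).

Lemma unif_lim_opR1 :
  bounded_derivatives 1 h ->
  unif_lim_C (fun xi => opR1 c psi kappa xi (fun z => RtoC (h z)))
    (fun y => (kappa / RtoC c * RtoC (h y))%C).
Proof.
intros hh.
unfold opR1; unif_lim_C_op.
Qed.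

Lemma unif_lim_opR2 :
  bounded_derivatives 1 h ->
  unif_lim_C (fun xi => opR2 c (rho U) psi xi (fun z => RtoC (h z)))
    (fun _ => RtoC 0).
Proof. intros hh; unfold opR2; unif_lim_C_op. Qed.

Lemma unif_lim_opR3 :
  bounded_derivatives 0 h ->
  unif_lim_C (fun xi => opR3 c (rho U) psi xi (fun z => RtoC (h z)))
    (fun y => (RtoC delta * RtoC (rhobar delta y) / RtoC c * RtoC (h y))%C).
Proof. intros hh; unfold opR3; unif_lim_C_op. Qed.

(** Only the term with g kappa survives; its own factor 1/q and the one in front of S_1 together
    give 1/c^2. *)
Lemma unif_lim_opS1 :
  bounded_derivatives 1 h ->
  unif_lim_C (fun xi => opS1 g c (rho U) psi kappa xi (fun z => RtoC (h z)))
    (fun y => (- (RtoC g * kappa / (RtoC c ^ 2 * RtoC (rhobar delta y)))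
               * RtoC (h y))%C).
Proof. intros hh; unfold opS1; unif_lim_C_op. Qed.

(** The combination h'' - delta h' is (rhobar h')' / rhobar. It also occurs in the limit of S_3 and
    equals - delta lambda_M h on the eigenfunction of index M, which produces the entries of A_M
    containing lambda_M. *)
Lemma unif_lim_opS2 :
  bounded_derivatives 3 h ->
  unif_lim_C (fun xi => opS2 g c (rho U) psi kappa xi (fun z => RtoC (h z)))
    (fun y => (kappa / RtoC c * (RtoC (Derive_n h 2 y)
                                 - RtoC delta * RtoC (Derive_n h 1 y)))%C).
Proof. intros hh; unfold opS2; unif_lim_C_op. Qed.

Lemma unif_lim_opS3 :
  bounded_derivatives 2 h ->
  unif_lim_C (fun xi => opS3 g c (rho U) psi kappa xi (fun z => RtoC (h z)))
    (fun y => (- (RtoC delta * RtoC g / RtoC c ^ 2) * RtoC (h y)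
               - (RtoC (Derive_n h 2 y) - RtoC delta * RtoC (Derive_n h 1 y)))%C).
Proof. intros hh; unfold opS3; unif_lim_C_op. Qed.

Lemma unif_lim_opS4 :
  bounded_derivatives 1 h ->
  unif_lim_C (fun xi => opS4 c (rho U) psi kappa xi (fun z => RtoC (h z)))
    (fun y => (kappa / RtoC c * RtoC (h y))%C).
Proof. intros hh; unfold opS4; unif_lim_C_op. Qed.

End OperatorLimits.

(** * The limit operator on the basis *)

Definition basis_real (delta : R) (phi : nat -> R -> R) (M k j : nat) (y : R) : R :=
  if Nat.eqb j k then
    match k with
    | O => Derive (rhobar delta) y * phi M y
    | _ => phi M y
    end
  else 0.

Lemma basis_RtoC (delta : R) (phi : nat -> R -> R) (M k j : nat) :
  basis delta phi M k j = fun y => RtoC (basis_real delta phi M k j y).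
Proof.
unfold basis, basis_real; destruct (Nat.eqb j k), k; reflexivity.
Qed.

Lemma bounded_derivatives_const (n : nat) (a : R) :
  bounded_derivatives n (fun _ => a).
Proof.
intros k _; apply (bounded_continuous_ext (fun _ => Derive_n (fun _ => a) k 0)).
- intros y _; destruct k; [easy | now rewrite !Derive_n_const].
- apply bounded_continuous_const.
Qed.

Lemma bounded_derivatives_le (m n : nat) (f : R -> R) :
  (m <= n)%nat -> bounded_derivatives n f -> bounded_derivatives m f.
Proof. intros hmn hf k hk; apply hf; lia. Qed.

(** Component 0 is met only by the first-order operators R_1 and S_1; on the others derivatives up
    to order 3 occur. *)
Lemma bounded_derivatives_basis (delta : R) (lam : nat -> R) (phi : nat -> R -> R)
    (M k j : nat) :
  0 < delta -> eigensystem delta lam phi ->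
  bounded_derivatives (if Nat.eqb j 0 then 1 else 3) (basis_real delta phi M k j).
Proof.
intros hd [_ [_ [_ [hphi _]]]].
assert (hb := eigenfunction_bounded_derivatives delta _ _ hd (hphi M)).
unfold basis_real; destruct (Nat.eqb_spec j k) as [-> | _];
  [ | apply bounded_derivatives_const].
destruct k; simpl Nat.eqb; cbv iota; trivial.
apply bounded_derivatives_Derive_rhobar_mult; trivial.
- now apply (bounded_derivatives_le 1 3); [lia | ].
- intros y hy; now apply hphi.
Qed.

(** The limit stays in mode [L]. The factor rhobar' = - delta rhobar of the first basis element
    absorbs the densities left by R_3 and S_1, and the eigenvalue equation removes the derivatives
    left by S_2 and S_3. [basis_real delta phi L i i] is the nonzero component of the basis element
    of row [i]. *)
Lemma unif_lim_opA (g delta c : R) (U : profile) (psi : R -> R -> R)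
    (lam : nat -> R) (phi : nat -> R -> R) (kappa : C) (L i j : nat) :
  0 < delta -> regular_isw g delta c U -> stream_function U psi ->
  eigensystem delta lam phi -> (i < 4)%nat -> (j < 4)%nat ->
  unif_lim_C (fun xi => opA g c (rho U) psi xi kappa (basis delta phi L j) i)
    (fun y => (coeff_mat (RtoC 0) (calA g delta c (lam L) kappa) i j
               * RtoC (basis_real delta phi L i i y))%C).
Proof.
intros hd hU hpsi hphi hi hj.
assert (hb := fun k => bounded_derivatives_basis delta lam phi L j k hd hphi).
assert (hb1 : forall k, bounded_derivatives 1 (basis_real delta phi L j k)).
{ intros k; apply (bounded_derivatives_le _ _ _) with (2 := hb k).
  destruct (Nat.eqb k 0); lia. }
assert (hb0 := fun k => bounded_derivatives_le 0 1 _ ltac:(lia) (hb1 k)).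
assert (hb3 : forall k, k <> 0%nat ->
  bounded_derivatives 3 (basis_real delta phi L j k)).
{ intros [ | k] hk; [easy | apply (hb (S k))]. }
assert (hb2 := fun k hk => bounded_derivatives_le 2 3 _ ltac:(lia) (hb3 k hk)).
assert (hode : forall y, 0 < y < 1 -> RtoC (Derive_n (phi L) 2 y)
  = (RtoC delta * (RtoC (Derive_n (phi L) 1 y) - RtoC (lam L) * RtoC (phi L y)))%C).
{ intros y hy; rewrite <- RtoC_mult, <- RtoC_minus, <- RtoC_mult; f_equal.
  apply (Derive_n_eigenfunction delta (lam L) (phi L) 0 y); trivial; [ | lia].
  now apply hphi. }
assert (hc := speed_neq_0 g delta c U hU).
assert (hr := rhobar_neq_0 delta).
assert (hr' : forall y, RtoC (Derive (rhobar delta) y)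
  = (- RtoC delta * RtoC (rhobar delta y))%C).
{ intros y; now rewrite Derive_rhobar, RtoC_mult, RtoC_opp. }
unfold calA; rewrite coeff_mat_bij by assumption.
destruct i as [ | [ | [ | [ | i]]]]; [ | | | | lia]; unfold opA;
  rewrite !basis_RtoC.
- apply (unif_lim_C_ext _ _ _ _ (fun _ _ _ => eq_refl)) with (2 :=
    unif_lim_C_plus _ _ _ _ (unif_lim_C_plus _ _ _ _
      (unif_lim_opR1 g delta c U psi hU hpsi kappa _ (hb1 0%nat))
      (unif_lim_opR2 g delta c U psi hU hpsi _ (hb1 1%nat)))
      (unif_lim_opR3 g delta c U psi hd hU hpsi _ (hb0 2%nat))).
  (* For each column [j] at most one summand is different from 0. *)
  intros y hy; destruct j as [ | [ | [ | [ | j]]]]; [ | | | | lia];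
    unfold basis_real; simpl; rewrite ?RtoC_mult, ?hr'; field; auto.
- apply (unif_lim_C_ext _ _ (fun y => RtoC (basis_real delta phi L j 2 y)) _
    (fun _ _ _ => eq_refl)).
  + intros y hy; destruct j as [ | [ | [ | [ | j]]]]; [ | | | | lia];
      unfold basis_real; simpl; ring.
  + apply unif_lim_RtoC, unif_lim_const, (hb0 2%nat 0%nat); lia.
- apply (unif_lim_C_ext _ _ (fun y => RtoC (basis_real delta phi L j 3 y)) _
    (fun _ _ _ => eq_refl)).
  + intros y hy; destruct j as [ | [ | [ | [ | j]]]]; [ | | | | lia];
      unfold basis_real; simpl; ring.
  + apply unif_lim_RtoC, unif_lim_const, (hb0 3%nat 0%nat); lia.
- apply (unif_lim_C_ext _ _ _ _ (fun _ _ _ => eq_refl)) with (2 :=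
    unif_lim_C_plus _ _ _ _ (unif_lim_C_plus _ _ _ _ (unif_lim_C_plus _ _ _ _
      (unif_lim_opS1 g delta c U psi hd hU hpsi kappa _ (hb1 0%nat))
      (unif_lim_opS2 g delta c U psi hd hU hpsi kappa _ (hb3 1%nat ltac:(lia))))
      (unif_lim_opS3 g delta c U psi hd hU hpsi kappa _ (hb2 2%nat ltac:(lia))))
      (unif_lim_opS4 g delta c U psi hd hU hpsi kappa _ (hb1 3%nat))).
  intros y hy.
  destruct j as [ | [ | [ | [ | j]]]]; [ | | | | lia];
    unfold basis_real; simpl Nat.eqb; cbv iota;
    change (fun y => phi L y) with (phi L);
    rewrite ?(Derive_n_const 0), ?(Derive_n_const 1), ?hode, ?RtoC_mult, ?hr',
      ?RtoC_div, ?RtoC_pow 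
      by (trivial; apply pow_nonzero; intros ->; now apply hc);
    field; auto.
Qed.

(** * Galerkin matrices *)

Lemma RInt_C_scal (k : C) (h : R -> R) :
  bounded_continuous h ->
  RInt (V := C_R_CompleteNormedModule) (fun y => (k * RtoC (h y))%C) 0 1
    = (k * RtoC (RInt h 0 1))%C.
Proof.
intros hh; apply bounded_continuous_ex_RInt in hh.
apply (is_RInt_unique (V := C_R_CompleteNormedModule)).
apply (RInt_correct (V := R_CompleteNormedModule)) in hh.
replace (k * RtoC (RInt h 0 1))%C
  with (fst k * RInt h 0 1, snd k * RInt h 0 1)
  by (destruct k; unfold Cmult, RtoC; simpl; f_equal; ring).
apply (is_RInt_fct_extend_pair (U := R_NormedModule) (V := R_NormedModule)).
- apply (is_RInt_ext (V := R_NormedModule) (fun y => scal (fst k) (h y))).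
  + intros y _; unfold scal; simpl; unfold mult; simpl; ring.
  + now apply (is_RInt_scal (V := R_NormedModule)).
- apply (is_RInt_ext (V := R_NormedModule) (fun y => scal (snd k) (h y))).
  + intros y _; unfold scal; simpl; unfold mult; simpl; ring.
  + now apply (is_RInt_scal (V := R_NormedModule)).
Qed.

(* The first component: the weight of [inner] is divided by [rhobar' ^ 2] there,
   and [U_M^1] carries a factor [rhobar']. *)
Definition dual_weight (delta : R) (phi : nat -> R -> R) (M i : nat) (y : R) : R :=
  match i with
  | O => - phi M y
  | _ => - Derive (rhobar delta) y * phi M y
  end.

(** A basis element has a single nonzero component, which merges with the weight of the inner
    product into [dual_weight]. *)
Lemma inner_basis (delta : R) (phi : nat -> R -> R) (V : state) (M i : nat) :
  0 < delta -> (i < 4)%nat ->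
  inner delta V (basis delta phi M i)
    = RInt (V := C_R_CompleteNormedModule)
        (fun y => (V i y * RtoC (dual_weight delta phi M i y))%C) 0 1.
Proof.
intros hd hi; apply (RInt_ext (V := C_R_CompleteNormedModule)); intros y _.
assert (hr : RtoC (Derive (rhobar delta) y) <> 0).
{ rewrite Derive_rhobar, RtoC_mult; apply Cmult_neq_0; [ | apply rhobar_neq_0].
  intros h; apply RtoC_inj in h; lra. }
destruct i as [ | [ | [ | [ | i]]]]; [ | | | | lia];
  unfold basis, dual_weight; simpl; rewrite ?RtoC_mult, ?RtoC_opp, ?RtoC_mult;
  field; exact hr.
Qed.

Lemma bounded_continuous_eigen_product (delta : R) (lam : nat -> R)
    (phi : nat -> R -> R) (L M : nat) :
  0 < delta -> eigensystem delta lam phi ->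
  bounded_continuous (fun y => - Derive (rhobar delta) y * phi L y * phi M y).
Proof.
intros hd hphi.
assert (hb : forall n, bounded_continuous (phi n)).
{ intros n; apply (eigenfunction_bounded_derivatives delta (lam n) (phi n) hd)
    with (k := 0%nat); [apply hphi | lia]. }
apply (bounded_continuous_ext (fun y => - (- delta * rhobar delta y) * phi L y * phi M y)).
- intros y _; now rewrite Derive_rhobar.
- repeat first [apply bounded_continuous_mult | apply bounded_continuous_opp];
    trivial; [apply bounded_continuous_const | now apply bounded_continuous_rhobar].
Qed.

(** For every [i] the component times the dual weight is - rhobar' phi_L phi_M, so the normalization
    of the eigenfunctions applies. *)
Lemma RInt_basis_component (delta : R) (lam : nat -> R) (phi : nat -> R -> R)
    (k : C) (L M i : nat) :
  0 < delta -> eigensystem delta lam phi ->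
  RInt (V := C_R_CompleteNormedModule)
    (fun y => (k * RtoC (basis_real delta phi L i i y)
               * RtoC (dual_weight delta phi M i y))%C) 0 1
  = if Nat.eqb M L then k else RtoC 0.
Proof.
intros hd hphi.
rewrite (RInt_ext (V := C_R_CompleteNormedModule) _
  (fun y => (k * RtoC (- Derive (rhobar delta) y * phi L y * phi M y))%C)).
- rewrite RInt_C_scal by now apply (bounded_continuous_eigen_product delta lam).
  destruct hphi as [_ [_ [_ [_ [_ ->]]]]].
  rewrite Nat.eqb_sym; destruct (Nat.eqb M L); [apply Cmult_1_r | apply Cmult_0_r].
- intros y _; unfold basis_real, dual_weight; rewrite Nat.eqb_refl.
  (* The equation is typed in the carrier of the module; [ring] needs it over [C]. *)
  match goal with |- ?a = ?b => change (@eq C a b) end.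
  destruct i; rewrite ?RtoC_mult, ?RtoC_opp; ring.
Qed.

Lemma inner_basis_basis (delta : R) (lam : nat -> R) (phi : nat -> R -> R)
    (L M i j : nat) :
  0 < delta -> eigensystem delta lam phi -> (i < 4)%nat ->
  inner delta (basis delta phi L j) (basis delta phi M i)
    = if andb (Nat.eqb i j) (Nat.eqb M L) then RtoC 1 else RtoC 0.
Proof.
intros hd hphi hi; rewrite inner_basis by assumption.
assert (hk := RInt_basis_component delta lam phi
  (if Nat.eqb i j then RtoC 1 else RtoC 0) L M i hd hphi).
replace (if andb (Nat.eqb i j) (Nat.eqb M L) then RtoC 1 else RtoC 0)
  with (if Nat.eqb M L then if Nat.eqb i j then RtoC 1 else RtoC 0 else RtoC 0)
  by now destruct (Nat.eqb i j), (Nat.eqb M L).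
refine (eq_trans _ hk); apply (RInt_ext (V := C_R_CompleteNormedModule)); intros y _.
rewrite basis_RtoC; unfold basis_real.
match goal with |- ?a = ?b => change (@eq C a b) end.
destruct (Nat.eqb_spec i j) as [-> | _]; [rewrite Nat.eqb_refl | ]; ring.
Qed.

Lemma proj_basis_seq (delta : R) (lam : nat -> R) (phi : nat -> R -> R)
    (N i : nat) :
  0 < delta -> eigensystem delta lam phi -> (i < 4 * N + 4)%nat ->
  proj delta phi N (basis_seq delta phi i) = basis_seq delta phi i.
Proof.
intros hd hphi hi.
apply functional_extensionality; intros j.
apply functional_extensionality; intros y.
assert (hin : forall k, inner delta (basis_seq delta phi i) (basis_seq delta phi k)
  = if Nat.eqb k i then RtoC 1 else RtoC 0).
{ intros k; unfold basis_seq.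
  rewrite (inner_basis_basis delta lam) by (trivial; apply Nat.mod_upper_bound; lia).
  (* Quotient and remainder by 4 determine the index, so two basis elements coincide in mode and
     component only if [k = i]. *)
  assert (h1 := Nat.div_mod_eq k 4); assert (h2 := Nat.div_mod_eq i 4).
  destruct (Nat.eqb_spec (k mod 4) (i mod 4)), (Nat.eqb_spec (k / 4) (i / 4)),
    (Nat.eqb_spec k i); simpl; trivial; subst; lia || congruence. }
unfold proj, lincomb.
rewrite (sum_n_ext _ (fun k => if Nat.eqb k i then basis_seq delta phi i j y
                               else RtoC 0)).
- assert (hsum : forall n, sum_n (fun k => if Nat.eqb k i
      then basis_seq delta phi i j y else RtoC 0) n
    = if Nat.leb i n then basis_seq delta phi i j y else RtoC 0).
  { induction n as [ | n IHn].
    - rewrite sum_O; now destruct i.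
    - rewrite sum_Sn, IHn.
      destruct (Nat.leb_spec i n), (Nat.leb_spec i (S n)), (Nat.eqb_spec (S n) i);
        try lia; [apply (plus_zero_r (G := C_AbelianMonoid))
                 | apply (plus_zero_l (G := C_AbelianMonoid))
                 | apply (plus_zero_l (G := C_AbelianMonoid))]. }
  rewrite hsum; destruct (Nat.leb_spec i (4 * N + 3)); [easy | lia].
- intros k; rewrite hin; destruct (Nat.eqb_spec k i) as [-> | _];
    [apply Cmult_1_l | apply Cmult_0_l].
Qed.

(** The projection fixes the basis elements of W_N, and the coordinates it gives to their images are
    the inner products collected in the Galerkin matrix. *)
Lemma represents_galerkin_matrix (delta : R) (lam : nat -> R)
    (phi : nat -> R -> R) (N : nat) (T : state -> state) :
  0 < delta -> eigensystem delta lam phi ->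
  represents delta phi N (fun W => proj delta phi N (T (proj delta phi N W)))
    (galerkin_matrix delta phi N T).
Proof.
intros hd hphi i hi j y _ _.
rewrite (proj_basis_seq delta lam) by assumption.
apply sum_n_ext_loc; intros k hk; unfold galerkin_matrix.
now rewrite coeff_mat_bij by lia.
Qed.

Lemma filterlim_inner_opA (g delta c : R) (U : profile) (psi : R -> R -> R)
    (lam : nat -> R) (phi : nat -> R -> R) (kappa : C) (L M i j : nat) :
  0 < delta -> regular_isw g delta c U -> stream_function U psi ->
  eigensystem delta lam phi -> (i < 4)%nat -> (j < 4)%nat ->
  filterlim
    (fun xi => inner delta (opA g c (rho U) psi xi kappa (basis delta phi L j))
                 (basis delta phi M i))
    at_infinity
    (locally (if Nat.eqb M L
              then coeff_mat (RtoC 0) (calA g delta c (lam M) kappa) i j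
              else RtoC 0)).
Proof.
intros hd hU hpsi hphi hi hj.
assert (hlim := unif_lim_opA g delta c U psi lam phi kappa L i j
  hd hU hpsi hphi hi hj).
assert (hw : unif_lim_C (fun _ y => RtoC (dual_weight delta phi M i y))
                        (fun y => RtoC (dual_weight delta phi M i y))).
{ apply unif_lim_RtoC, unif_lim_const.
  assert (hb : bounded_continuous (phi M)).
  { apply (eigenfunction_bounded_derivatives delta (lam M) (phi M) hd)
      with (k := 0%nat); [apply hphi | lia]. }
  destruct i; simpl; [now apply bounded_continuous_opp | ].
  apply (bounded_continuous_ext (fun y => - (- delta * rhobar delta y) * phi M y)).
  - intros y _; now rewrite Derive_rhobar.
  - repeat first [apply bounded_continuous_mult | apply bounded_continuous_opp];
      trivial; [apply bounded_continuous_const | now apply bounded_continuous_rhobar]. }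
assert (h := unif_lim_C_RInt _ _ (unif_lim_C_mult _ _ _ _ hlim hw)).
cbv beta in h; rewrite (RInt_basis_component delta lam) in h by assumption.
(* The limit was computed with [lam L]; on the diagonal this is [lam M]. *)
destruct (Nat.eqb_spec M L) as [-> | _];
  refine (filterlim_ext _ _ _ h); intros xi; symmetry; now apply inner_basis.
Qed.

(** * Remainder blocks and the block form *)

Definition galerkin_remainder (g delta c : R) (U : profile) (psi : R -> R -> R)
    (lam : nat -> R) (phi : nat -> R -> R) (M L : nat) (xi : R) (kappa : C) :
    @matrix C 4 4 :=
  mk_matrix 4 4 (fun i j =>
    (inner delta (opA g c (rho U) psi xi kappa (basis delta phi L j))
       (basis delta phi M i)
     - (if Nat.eqb M L
        then coeff_mat (RtoC 0) (calA g delta c (lam M) kappa) i j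
        else RtoC 0))%C).

Lemma filterlim_minus_const {T : Type} (F : (T -> Prop) -> Prop) {FF : Filter F}
    (f : T -> C) (l : C) :
  filterlim f F (locally l) ->
  filterlim (fun x => (f x - l)%C) F (locally (RtoC 0)).
Proof.
intros hf; apply (filterlim_locally (U := C_UniformSpace)); intros eps.
generalize (proj1 (filterlim_locally (U := C_UniformSpace) f l) hf eps).
apply filter_imp; intros x [h1 h2].
(* Balls of [C] are products of real balls, so the translation is checked in each component. *)
assert (hball : forall a b : R, ball a eps b -> ball 0 eps (b + - a)).
{ intros a b h; change (Rabs (b - a) < eps) in h.
  change (Rabs (b + - a - 0) < eps); now rewrite Rminus_0_r. }
split; now apply hball.
Qed.

Lemma at_infinity_p_infty : filter_le (Rbar_locally p_infty) at_infinity.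
Proof.
intros P [X hX]; exists (Rabs X); intros xi hxi; apply hX.
apply Rle_lt_trans with (1 := Rle_abs X).
apply Rlt_le_trans with (1 := hxi), Rle_abs.
Qed.

Lemma at_infinity_m_infty : filter_le (Rbar_locally m_infty) at_infinity.
Proof.
intros P [X hX]; exists (- Rabs X); intros xi hxi; apply hX.
apply Rle_lt_trans with (1 := Rle_abs X).
rewrite <- (Rabs_Ropp xi); apply Rlt_le_trans with (- xi); [lra | apply Rle_abs].
Qed.

Theorem theorem2 (g delta c : R) (U : profile) (psi : R -> R -> R)
  (lam : nat -> R) (phi : nat -> R -> R)
  (hg : 0 < g) (hdelta : 0 < delta)
  (hU : regular_isw g delta c U)
  (hpsi : stream_function U psi)
  (hphi : eigensystem delta lam phi) :
  exists B : nat -> nat -> R -> C -> @matrix C 4 4,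
    (forall (N : nat) (xi : R) (kappa : C),
       let A := opA g c (rho U) psi xi kappa in
       let NA := galerkin_matrix delta phi N A in
       represents delta phi N
         (fun W => proj delta phi N (A (proj delta phi N W))) NA /\
       NA = block_matrix N (fun M L =>
              if Nat.eqb M L
              then Mplus (calA g delta c (lam M) kappa) (B M L xi kappa)
              else B M L xi kappa)) /\
    (forall (M L : nat) (kappa : C) (i j : nat), (i < 4)%nat -> (j < 4)%nat ->
       filterlim (fun xi => coeff_mat (RtoC 0) (B M L xi kappa) i j)
         (Rbar_locally p_infty) (locally (RtoC 0)) /\
       filterlim (fun xi => coeff_mat (RtoC 0) (B M L xi kappa) i j)
         (Rbar_locally m_infty) (locally (RtoC 0))).
Proof.
assert (hcancel : forall k z : C, (k + (z - k))%C = z) by (intros; ring).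
assert (hminus : forall z : C, (z - RtoC 0)%C = z) by (intros; ring).
exists (galerkin_remainder g delta c U psi lam phi); split.
- intros N xi kappa A NA; split.
  + now apply (represents_galerkin_matrix delta lam).
  + apply mk_matrix_ext; intros i j _ _.
    assert (hi : (i mod 4 < 4)%nat) by (apply Nat.mod_upper_bound; lia).
    assert (hj : (j mod 4 < 4)%nat) by (apply Nat.mod_upper_bound; lia).
    (* Equal quotients mean a diagonal block, where adding A_M undoes the subtraction in the
       remainder; elsewhere only 0 was subtracted. *)
    destruct (Nat.eqb (i / 4) (j / 4)) eqn:hij; unfold Mplus, galerkin_remainder;
      rewrite !coeff_mat_bij by assumption; rewrite hij; symmetry.
    * apply (hcancel (coeff_mat (RtoC 0) (calA g delta c (lam (i / 4)%nat) kappa)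
        (i mod 4) (j mod 4))).
    * apply hminus.
- intros M L kappa i j hi hj.
  (* The limits at both ends are restrictions of a single limit as |xi| grows. *)
  assert (h : filterlim
    (fun xi => coeff_mat (RtoC 0)
       (galerkin_remainder g delta c U psi lam phi M L xi kappa) i j)
    at_infinity (locally (RtoC 0))).
  { refine (filterlim_ext _ _ _ (filterlim_minus_const _ _ _
      (filterlim_inner_opA g delta c U psi lam phi kappa L M i j
        hdelta hU hpsi hphi hi hj))).
    intros xi; unfold galerkin_remainder; now rewrite coeff_mat_bij. }
  split; apply (filterlim_filter_le_1 _ (F := at_infinity)); trivial.
  + apply at_infinity_p_infty.
  + apply at_infinity_m_infty.
Qed.
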